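(* Let $P$ be a simplicial poset, $K$ a field, and $x\in P$. Then the $\mathbb{Z}^n$-graded $S$-module $E_x$ (constructed explicitly in the context) is the *injective envelope of $S_x=S/\mathfrak{p}_x$; that is, $E_x$ is an injective object of ${}^*\mathrm{Mod}\,S$, and it is a *essential extension of its submodule $S_x$.
   Context: Face ring. A simplicial poset is a finite poset $P$ with least element $\hat 0$ such that $\{y\in P\mid y\le x\}$ is isomorphic to a boolean algebra for every $x\in P$; $\operatorname{rank} x$ is the rank of this boolean algebra. Put $P^*=P\setminus\{\hat 0\}$. For $x_1,\dots,x_m\in P$, $[x_1\vee\cdots\vee x_m]$ is the set of minimal elements of $\{z\in P\mid z\ge x_1,\dots,x_m\}$. If $[x\vee y]\neq\emptyset$, then $\{z\mid z\le x,\ z\le y\}$ has a greatest element $x\wedge y$. Let $S=K[t_x\mid x\in P^*]$ be the polynomial ring over the field $K$, set $t_{\hat 0}=1$, and for $x,y\in P^*$ let $f_{x,y}=t_xt_y-t_{x\wedge y}\sum_{z\in[x\vee y]}t_z$ (interpreted as $t_xt_y$ if $[x\vee y]=\emptyset$). Let $I_P=(f_{x,y}\mid x,y\in P^* )\subset S$. Grading. Let $y_1,\dots,y_n$ be the rank 1 elements of $P$, $t_i:=t_{y_i}$, and $\operatorname{supp}(x)=\{i\mid y_i\le x\}$ for $x\in P$. $S$ is $\mathbb{Z}^n$-graded by $\deg t_x=\sum_{i\in\operatorname{supp}(x)}\mathbf{e}_i$, where $\mathbf e_i$ is the $i$-th coordinate vector. ${}^*\mathrm{Mod}\,S$ is the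 category of $\mathbb{Z}^n$-graded $S$-modules and degree-preserving $S$-homomorphisms. A graded module $M$ is a *essential extension of a graded submodule $N$ if $S\alpha\cap N\ne 0$ for every nonzero homogeneous $\alpha\in M$. The module $E_x$. For $x\in P$ let $\mathfrak{p}_x=(t_z\mid z\in P^*, z\not\le x)+I_P$, and $S_x=S/\mathfrak{p}_x\cong K[t_i\mid i\in\operatorname{supp}(x)]$; the surjection $\pi_x:S\to S_x$ sends $t_z$ to $\prod_{i\in\operatorname{supp}(z)}t_i$ if $z\le x$, and to $0$ otherwise. Let $P^*_{-x}=P^*\setminus\{y_i\mid i\in\operatorname{supp}(x)\}$ and $$E_x=K[t_i^{\pm1}\mid i\in\operatorname{supp}(x)]\otimes_K K[t_z^{-1}\mid z\in P^*_{-x}].$$ Here the first factor is an $S$-module via $\pi_x$; the second is Macaulay's inverse system, an $S$-module on which $t_i$ ($i\in\operatorname{supp}(x)$) acts as $0$ and $t_w$ ($w\in P^*_{-x}$) sends a monomial $\prod_z t_z^{-a_z}$ ($a_z\in\mathbb{N}$, with $0\in\mathbb N$) to the monomial with $a_w$ replaced by $a_w-1$ if $a_w>0$, and to $0$ if $a_w=0$. $S$ acts on $E_x$ by $t_z\cdot(u\otimes v)=\pi_x(t_z)u\otimes v+u\otimes t_zv$ for $z\in P^*$ (i.e. via the ring homomorphism $S\to S\otimes_KS$, $t_z\mapsto t_z\otimes1+1\otimes t_z$). $E_x$ is $\mathbb{Z}^n$-graded by $\deg(u\otimes v)=\deg u+\deg v$, with $\deg t_z^{-1}=-\deg t_z$.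 $S_x$ is regarded as the submodule $K[t_i\mid i\in\operatorname{supp}(x)]\otimes 1$ of $E_x$. *)

(* Defs.v *)
From HB Require Import structures.
From mathcomp Require Import all_boot all_order all_algebra.
From mathcomp Require Import finmap boolp.
From mathcomp Require Import monalg.

Set Implicit Arguments.
Unset Strict Implicit.
Unset Printing Implicit Defensive.

Import Order.TTheory GRing.Theory.

Local Open Scope quotient_scope.
Local Open Scope ring_scope.

(* The K-linear map {malg K[B]} -> V with value h b on the basis element b. *)
Section LinExt.
Variables (K : fieldType) (B : choiceType) (V : lmodType K).
Implicit Types (h : B -> V) (v : {malg K[B]}).

Definition linext h v : V := \sum_(b <- msupp v) v@_b *: h b.

Lemma linextEw h v (D : {fset B}) : (msupp v `<=` D)%fset ->
  linext h v = \sum_(b <- D) v@_b *: h b.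
Proof.
move=> le; rewrite /linext (big_fset_incl _ le) => //= b _ /mcoeff_outdom ->.
by rewrite scale0r.
Qed.

Lemma linext_is_linear h : linear (linext h).
Proof.
move=> c u v; pose D := (msupp u `|` msupp v `|` msupp (c *: u + v))%fset.
rewrite !(@linextEw _ _ D) ?fsubsetUr //.
- rewrite scaler_sumr -big_split /=; apply: eq_bigr => b _.
  by rewrite mcoeffD mcoeffZ scalerDl scalerA.
- by rewrite /D -fsetUA [(_ `|` (_ `|` _))%fset]fsetUCA fsubsetUl.
- by rewrite /D -fsetUA fsubsetUl.
Qed.

HB.instance Definition _ h :=
  GRing.isLinear.Build K {malg K[B]} V *:%R (linext h) (linext_is_linear h).

Lemma linextU h b : linext h << b >> = h b.
Proof.
by rewrite (linextEw _ (msuppU_le)) big_seq_fset1 mcoeffUU scale1r.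
Qed.

Lemma malg_scaleU (c : K) (b : B) : << c *g b >> = c *: << b >> :> {malg K[B]}.
Proof. by apply/malgP => k; rewrite mcoeffZ !mcoeffU mulrnAr mulr1. Qed.

Lemma malg_basis v : v = \sum_(b <- msupp v) v@_b *: << b >>.
Proof.
by rewrite {1}[v]monalgE; apply: eq_bigr => b _; rewrite malg_scaleU.
Qed.

Lemma linear_ext_basis (f g : {linear {malg K[B]} -> V}) :
  (forall b, f << b >> = g << b >>) -> forall v, f v = g v.
Proof.
move=> fg v; rewrite [v]malg_basis !linear_sum.
by apply: eq_bigr => b _; rewrite !linearZ /= fg.
Qed.

End LinExt.

(* The action of the polynomial ring K[t_i | i : I] on a K-space V on which
   t_i acts as the operator T i, the T i being pairwise commuting. *)
Section PolyAction.
Variables (K : fieldType) (I : finType) (V : lmodType K).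
Variable (T : I -> {linear V -> V}).

Definition monact (m : {cmonom I}) (v : V) : V :=
  foldr (fun i => iter (m i) (T i)) v (enum I).

Definition polyact (p : {malg K[{cmonom I}]}) (v : V) : V :=
  linext (fun m => monact m v) p.

Hypothesis Tcomm : forall i j v, T i (T j v) = T j (T i v).

Lemma monact_is_linear m : linear (monact m).
Proof.
move=> c u v; rewrite /monact; elim: (enum I) => //= i s ->.
by elim: (m i) => //= n ->; rewrite linearP.
Qed.

HB.instance Definition _ m :=
  GRing.isLinear.Build K V V *:%R (monact m) (monact_is_linear m).

Lemma monact1 v : monact mone v = v.
Proof. by rewrite /monact; elim: (enum I) => //= i s ->; rewrite cm1. Qed.

Lemma monactM m1 m2 v : monact (mmul m1 m2) v = monact m1 (monact m2 v).
Proof.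
have iterT i a w n : T i (iter n (T a) w) = iter n (T a) (T i w).
  by elim: n => //= n <-; rewrite Tcomm.
have iterC n i k a w :
    iter n (T i) (iter k (T a) w) = iter k (T a) (iter n (T i) w).
  by elim: n => //= n ->; rewrite iterT.
rewrite /monact; elim: (enum I) => //= i s IHs; rewrite IHs cmM iterD.
congr iter; elim: s (foldr _ v s) {IHs} => //= j s IHs w.
by rewrite iterC IHs.
Qed.

Lemma monactU i v : monact (ucm i) v = T i v.
Proof.
have key (s : seq I) : uniq s ->
    foldr (fun j => iter (ucm i j) (T j)) v s = if i \in s then T i v else v.
  elim: s => //= j s IH /andP[js us]; rewrite in_cons cmU IH //.
  by case: eqVneq js => [<-|_] js //=; rewrite (negbTE js).
by rewrite /monact key ?enum_uniq // mem_enum.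
Qed.

Lemma polyactA p q v : polyact p (polyact q v) = polyact (p * q) v.
Proof.
pose f := linext (fun m => polyact (<< m >>) (polyact q v)).
pose g := linext (fun m => polyact (<< m >> * q) v).
have mE m w : polyact << m >> w = monact m w by rewrite /polyact linextU.
have -> : polyact p (polyact q v) = f p.
  by rewrite /f /polyact; apply: eq_bigr => m _; rewrite linextU.
have -> : polyact (p * q) v = g p.
  rewrite {1}[p]malg_basis mulr_suml /polyact linear_sum /g /linext.
  by apply: eq_bigr => m _; rewrite -scalerAl linearZ.
rewrite /f /g; apply: eq_bigr => m _; congr (_ *: _).
rewrite mE {2}[q]malg_basis mulr_sumr /polyact !linear_sum.
apply: eq_bigr => k _; rewrite -scalerAr !linearZ /=; congr (_ *: _).
have -> : << m >> * << k >> = << mmul m k >> :> {malg K[{cmonom I}]}.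
  by rewrite malgM_def fgmulUU mulr1.
by rewrite linextU monactM.
Qed.

Lemma polyact1 : left_id 1 polyact.
Proof. by move=> v; rewrite /polyact linextU monact1. Qed.

Lemma polyactDr : right_distributive polyact +%R.
Proof.
move=> p u v; rewrite /polyact /linext -big_split /=.
by apply: eq_bigr => m _; rewrite linearD scalerDr.
Qed.

Lemma polyactDl v : {morph polyact^~ v : p q / p + q}.
Proof. by move=> p q; rewrite /polyact linearD. Qed.

End PolyAction.

Section Poset.
Variables (d : Order.disp_t) (P : finBPOrderType d).
Implicit Types x y z w : P.

(* {y | y <= x} is isomorphic to the boolean algebra of subsets of an
   r-element set, i.e. the boolean algebra of rank r *)
Definition boolean_of_rank x (r : nat) : bool :=
  [exists f : {ffun {y : P | (y <= x)%O} -> {set 'I_r}},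
    [&& injectiveb f, [forall A, A \in codom f]
      & [forall y, forall z, (f y \subset f z) == (val y <= val z)%O]]].

Definition simplicial_poset : Prop := forall x, exists r, boolean_of_rank x r.

Definition pstar : predArgType := {z : P | z != \bot%O}.

(* [x \vee y] *)
Definition joins x y : {set P} :=
  [set z | [&& (x <= z)%O, (y <= z)%O
    & [forall w, [&& (x <= w)%O, (y <= w)%O & (w <= z)%O] ==> (w == z)]]].

(* \bot is a junk value, used when there is no greatest lower bound *)
Definition pmeet x y : P :=
  odflt \bot%O [pick z | [&& (z <= x)%O, (z <= y)%O
    & [forall w, [&& (w <= x)%O & (w <= y)%O] ==> (w <= z)%O]]].

Definition rank1 : {set P} := [set y | boolean_of_rank y 1].
Definition nvert : nat := #|rank1|.
Definition vert (i : 'I_nvert) : P := enum_val i.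

Definition supp x : {set 'I_nvert} := [set i | (vert i <= x)%O].

Definition deg x : 'rV[int]_nvert := \sum_(i in supp x) delta_mx 0 i.

End Poset.

HB.instance Definition _ d (P : finBPOrderType d) := Finite.on (pstar P).

Notation polyS K P := {malg K[{cmonom (pstar P)}]}.

Section FaceRing.
Variables (K : fieldType) (d : Order.disp_t) (P : finBPOrderType d).
Local Notation S := (polyS K P).

(* t_x, with t_\bot = 1 *)
Definition tvar (x : P) : S :=
  if insub x is Some z then << @ucm (pstar P) z >> else 1.

Definition face_rel (x y : P) : S :=
  tvar x * tvar y - tvar (pmeet x y) * \sum_(z in joins x y) tvar z.

Definition ideal_gen (G : S -> Prop) (p : S) : Prop :=
  exists2 s : seq (S * S), (forall c, c \in s -> G c.2)
    & p = \sum_(c <- s) c.1 * c.2.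

Definition face_ideal : S -> Prop :=
  ideal_gen (fun g => exists x y : pstar P, g = face_rel (val x) (val y)).

Definition prime_ideal (x : P) (p : S) : Prop :=
  exists q r, [/\ p = q + r, face_ideal r
    & ideal_gen (fun g => exists2 z : pstar P,
        ~~ (val z <= x)%O & g = tvar (val z)) q].

Definition mondeg (m : {cmonom (pstar P)}) : 'rV[int]_(nvert P) :=
  \sum_(z : pstar P) deg (val z) *+ m z.

Definition homogS (a : 'rV[int]_(nvert P)) (p : S) : Prop :=
  forall m, m \in msupp p -> mondeg m = a.

(* M = \bigoplus_a M_a as additive groups, with S_a M_b contained in M_(a+b) *)
Definition is_grading (M : lmodType S) (homog : 'rV[int]_(nvert P) -> M -> Prop)
  : Prop :=
  [/\ forall a, homog a 0,
      forall a u v, homog a u -> homog a v -> homog a (u - v),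
      forall a b p u, homogS a p -> homog b u -> homog (a + b) (p *: u),
      forall u, exists (s : seq 'rV[int]_(nvert P)) (c : 'rV[int]_(nvert P) -> M),
        (forall a, homog a (c a)) /\ u = \sum_(a <- s) c a
    & forall (s : seq 'rV[int]_(nvert P)) (c : 'rV[int]_(nvert P) -> M),
        uniq s -> (forall a, homog a (c a)) -> \sum_(a <- s) c a = 0 ->
        forall a, a \in s -> c a = 0].

Record grmod := GrMod {
  grmod_sort :> lmodType S;
  homog : 'rV[int]_(nvert P) -> grmod_sort -> Prop;
  grmodP : is_grading homog }.

Definition degree_preserving (M N : grmod) (f : M -> N) : Prop :=
  forall a u, homog a u -> homog a (f u).

(* the monomorphisms of the category of graded modules are its injective
   morphisms *)
Definition star_injective (E : grmod) : Prop :=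
  forall (N M : grmod) (i : {linear N -> M}) (g : {linear N -> E}),
    degree_preserving i -> injective i -> degree_preserving g ->
    exists2 h : {linear M -> E}, degree_preserving h & forall u, h (i u) = g u.

Definition graded_submodule (M : grmod) (N : M -> Prop) : Prop :=
  [/\ N 0, forall u v, N u -> N v -> N (u + v), forall p u, N u -> N (p *: u)
    & forall u, N u -> exists (s : seq 'rV[int]_(nvert P))
        (c : 'rV[int]_(nvert P) -> M),
        (forall a, homog a (c a) /\ N (c a)) /\ u = \sum_(a <- s) c a].

Definition star_essential (M : grmod) (N : M -> Prop) : Prop :=
  graded_submodule N /\
  forall a (u : M), homog a u -> u != 0 ->
    exists p : S, N (p *: u) /\ p *: u != 0.

End FaceRing.

Arguments homog {K d P} g.

Section Envelope.
Variables (K : fieldType) (d : Order.disp_t) (P : finBPOrderType d) (x : P).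
Local Notation S := (polyS K P).

Definition vx : predArgType := {i : 'I_(nvert P) | i \in supp x}.
Definition pminus : predArgType :=
  {z : pstar P | val z \notin [set vert i | i in supp x]}.

HB.instance Definition _ := Finite.on vx.
HB.instance Definition _ := Finite.on pminus.

Definition lexp : predArgType := {ffun vx -> int}.
Definition iexp : predArgType := {ffun pminus -> nat}.

HB.instance Definition _ := GRing.Zmodule.on lexp.
HB.instance Definition _ := Choice.on iexp.

(* K[t_i | i in supp x] *)
Local Notation polyx := {malg K[{cmonom vx}]}.
(* K[t_i^{+-1} | i in supp x]; a : lexp stands for prod_i t_i^(a i) *)
Local Notation laurent := {malg K[lexp]}.
(* K[t_z^{-1} | z in P^*_{-x}]; b : iexp stands for prod_z t_z^(- b z) *)
Local Notation invsys := {malg K[iexp]}.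
(* the tensor product over K of the last two, on the tensors of monomials *)
Local Notation tensor := {malg K[(lexp * iexp)%type]}.

Definition pi_var (z : P) : polyx :=
  if (z <= x)%O then \prod_(i : vx | val i \in supp z) << ucm i >> else 0.

Definition pi_x (p : S) : polyx :=
  linext (fun m : {cmonom (pstar P)} => \prod_(z : pstar P) pi_var (val z) ^+ m z) p.

(* the inclusion of K[t_i] in K[t_i^{+-1}] *)
Definition poly_laurent (u : polyx) : laurent :=
  linext (fun m : {cmonom vx} => << ([ffun i => (m i)%:Z] : lexp) >>) u.

Definition lmul (u v : laurent) : laurent :=
  linext (fun a => linext (fun b => << (a + b : lexp) >>) v) u.

(* K[t_i^{+-1}] as an S-module via pi_x *)
Definition laurent_act (p : S) (u : laurent) : laurent :=
  lmul (poly_laurent (pi_x p)) u.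

Definition idec (w : pminus) (b : iexp) : iexp :=
  [ffun y => b y - (y == w)]%N.

(* The t_z with z outside P^*_{-x} act as 0. *)
Definition inv_act (z : pstar P) (v : invsys) : invsys :=
  linext (fun b : iexp =>
    if insub z is Some w then
      if (0 < b w)%N then << idec w b >> else 0
    else 0) v.

Definition one_inv : invsys := << ([ffun => 0%N] : iexp) >>.

Definition tens (u : laurent) (v : invsys) : tensor :=
  linext (fun a => linext (fun b => << (a, b) >>) v) u.

(* u \otimes v |-> pi_x(t_z) u \otimes v + u \otimes t_z v *)
Definition env_act (z : pstar P) (e : tensor) : tensor :=
  linext (fun c => tens (laurent_act (tvar K (val z)) << c.1 >>) << c.2 >>
                   + tens << c.1 >> (inv_act z << c.2 >>)) e.

Lemma env_act_is_linear z : linear (env_act z).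
Proof. exact: linext_is_linear. Qed.

HB.instance Definition _ z :=
  GRing.isLinear.Build K tensor tensor *:%R (env_act z) (env_act_is_linear z).

Definition envdeg (c : lexp * iexp) : 'rV[int]_(nvert P) :=
  \sum_(i : vx) delta_mx 0 (val i) *~ c.1 i
  - \sum_(w : pminus) deg (val (val w)) *+ c.2 w.

Definition env_homog (a : 'rV[int]_(nvert P)) (e : tensor) : Prop :=
  forall c, c \in msupp e -> envdeg c = a.

Definition lexp_shift (z : P) (a : lexp) : lexp :=
  a + [ffun i => (val i \in supp z)%:Z].

Lemma tensU a b : tens << a >> << b >> = << (a, b) >>.
Proof. by rewrite /tens !linextU. Qed.

Lemma tens0l v : tens 0 v = 0.
Proof. by rewrite /tens linear0. Qed.

Lemma tens0r a : tens << a >> 0 = 0.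
Proof. by rewrite /tens linextU linear0. Qed.

Lemma pi_x_tvar (z : pstar P) : pi_x (tvar K (val z)) = pi_var (val z).
Proof.
rewrite /tvar valK /pi_x linextU (bigD1 z) //= cmUU expr1 big1 ?mulr1 // => w.
by rewrite cmU eq_sym => /negbTE ->.
Qed.

Lemma pi_var_le (z : P) : (z <= x)%O ->
  poly_laurent (pi_var z) = << ([ffun i => (val i \in supp z)%:Z] : lexp) >>.
Proof.
move=> zx; rewrite /pi_var zx.
have -> : \prod_(i : vx | val i \in supp z) << ucm i >>
    = << \big[@mmul _/mone]_(i : vx | val i \in supp z) ucm i >> :> polyx.
  by symmetry; apply: (big_morph (fun m => << m >>)) => // m k;
    rewrite malgM_def fgmulUU mulr1.
rewrite /poly_laurent linextU; congr << _ >>; apply/ffunP => i; rewrite !ffunE.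
congr Posz.
rewrite (big_morph (fun m : {cmonom vx} => m i) (fun m k => cmM i m k) (cm1 i)).
rewrite big_mkcond (bigD1 i) //= cmUU big1 => [|j /negbTE ji].
  by case: (_ \in _).
by rewrite cmU ji; case: (_ \in _).
Qed.

Lemma laurent_actU (z : pstar P) a :
  laurent_act (tvar K (val z)) << a >>
  = if (val z <= x)%O then << lexp_shift (val z) a >> else 0.
Proof.
rewrite /laurent_act pi_x_tvar; case: ifP => zx; last first.
  by rewrite /pi_var zx /poly_laurent linear0 /lmul linear0.
by rewrite pi_var_le // /lmul !linextU /lexp_shift addrC.
Qed.

Definition lopt (z : P) (c : lexp * iexp) : option (lexp * iexp) :=
  if (z <= x)%O then Some (lexp_shift z c.1, c.2) else None.

Definition iopt (z : pstar P) (c : lexp * iexp) : option (lexp * iexp) :=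
  if insub z is Some w then
    if (0 < c.2 w)%N then Some (c.1, idec w c.2) else None
  else None.

Definition partial_act (f : lexp * iexp -> option (lexp * iexp)) (e : tensor) :
    tensor :=
  linext (fun c => if f c is Some c' then << c' >> else 0) e.

Lemma partial_act_is_linear f : linear (partial_act f).
Proof. exact: linext_is_linear. Qed.

HB.instance Definition _ f := GRing.isLinear.Build K tensor tensor *:%R
  (partial_act f) (partial_act_is_linear f).

Lemma partial_actD f u v :
  partial_act f (u + v) = partial_act f u + partial_act f v.
Proof. exact: (linearD (partial_act f)). Qed.

Lemma env_actE z e :
  env_act z e = partial_act (lopt (val z)) e + partial_act (iopt z) e.
Proof.
rewrite /env_act /partial_act /linext -big_split /=; apply: eq_bigr => c _.
rewrite -scalerDr laurent_actU /inv_act linextU /lopt /iopt; congr (_ *: (_ + _)).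
  by case: ifP => _; rewrite ?tensU ?tens0l.
by case: insub => [w|]; rewrite ?tens0r //; case: ifP => _; rewrite ?tensU ?tens0r.
Qed.

Lemma partial_act_comm f g :
  (forall c, obind f (g c) = obind g (f c)) ->
  forall e, partial_act f (partial_act g e) = partial_act g (partial_act f e).
Proof.
move=> fg e; apply: (@linear_ext_basis _ _ _ (partial_act f \o partial_act g)
                       (partial_act g \o partial_act f)) => c /=.
have comp h k : partial_act h (partial_act k << c >>)
    = if obind h (k c) is Some c' then << c' >> else 0.
  by rewrite {2}/partial_act linextU; case: (k c) => [c'|] /=;
    rewrite ?linear0 // /partial_act linextU.
by rewrite !comp fg.
Qed.

Local Opaque partial_act.

Lemma env_act_comm (z w : pstar P) e :
  env_act z (env_act w e) = env_act w (env_act z e).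
Proof.
rewrite (env_actE z (env_act w e)) (env_actE w e).
rewrite (env_actE w (env_act z e)) (env_actE z e).
set f1 := lopt (val z); set f2 := iopt z.
set g1 := lopt (val w); set g2 := iopt w.
suff [c11 c12 c21 c22] :
    [/\ forall c, obind f1 (g1 c) = obind g1 (f1 c),
        forall c, obind f1 (g2 c) = obind g2 (f1 c),
        forall c, obind f2 (g1 c) = obind g1 (f2 c)
      & forall c, obind f2 (g2 c) = obind g2 (f2 c)].
  rewrite (partial_actD f1 (partial_act g1 e) (partial_act g2 e)).
  rewrite (partial_actD f2 (partial_act g1 e) (partial_act g2 e)).
  rewrite (partial_actD g1 (partial_act f1 e) (partial_act f2 e)).
  rewrite (partial_actD g2 (partial_act f1 e) (partial_act f2 e)).
  rewrite (partial_act_comm c11 e) (partial_act_comm c12 e).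
  rewrite (partial_act_comm c21 e) (partial_act_comm c22 e).
  exact: addrACA.
rewrite {}/f1 {}/f2 {}/g1 {}/g2; split=> -[a b].
- rewrite /lopt.
  by case: ifP => wx; case: ifP => zx /=; rewrite ?wx ?zx // /lexp_shift addrAC.
- rewrite /lopt /iopt.
  by case: ifP => zx /=; case: insub => //= u; case: ifP => //= _; rewrite zx.
- rewrite /lopt /iopt.
  by case: ifP => zx /=; case: insub => //= u; case: ifP => //= _; rewrite zx.
- rewrite /iopt.
  case: (insub w) (insub z) => [v|] [u|] //=; first last.
  - by case: ifP.
  - by case: ifP.
  have dC : idec u (idec v b) = idec v (idec u b).
    by apply/ffunP => k; rewrite !ffunE subnAC.
  have [->//|uv] := eqVneq u v.
  have uE : idec v b u = b u by rewrite ffunE (negbTE uv) subn0.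
  have vE : idec u b v = b v by rewrite ffunE eq_sym (negbTE uv) subn0.
  by case bv: (0 < b v)%N; case bu: (0 < b u)%N;
    rewrite //= ?uE ?vE ?bu ?bv ?dC.
Qed.

Local Transparent partial_act.

(* E_x as a set; this alias carries the S-module structure *)
Definition env : Type := tensor.
HB.instance Definition _ := GRing.Zmodule.copy env tensor.

Definition env_scale (p : S) (e : env) : env := polyact env_act p e.

Lemma env_scaleA p q e : env_scale p (env_scale q e) = env_scale (p * q) e.
Proof. exact: (polyactA env_act_comm). Qed.

Lemma env_scale1 : left_id 1 env_scale.
Proof. exact: polyact1. Qed.

Lemma env_scaleDr : right_distributive env_scale +%R.
Proof. exact: polyactDr. Qed.

Lemma env_scaleDl e : {morph env_scale^~ e : p q / p + q}.
Proof. exact: polyactDl. Qed.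

HB.instance Definition _ := GRing.Zmodule_isLmodule.Build S env
  env_scaleA env_scale1 env_scaleDr env_scaleDl.

Lemma env_scale_tvar (z : pstar P) (e : env) : tvar K (val z) *: e = env_act z e.
Proof.
rewrite /tvar valK; change (polyact env_act << ucm z >> e = env_act z e).
by rewrite /polyact linextU monactU.
Qed.

Lemma env_homogP a e :
  env_homog a e <-> forall c, envdeg c != a -> e@_c = 0.
Proof.
split=> [h c|h c]; last by rewrite -mcoeff_neq0; apply: contraTeq => /h ->; rewrite eqxx.
by move=> ca; apply: mcoeff_outdom; apply: contra ca => /h ->.
Qed.

Lemma env_homog0 a : env_homog a 0.
Proof. by apply/env_homogP => c _; rewrite mcoeff0. Qed.

Lemma env_homogD a u v : env_homog a u -> env_homog a v -> env_homog a (u + v).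
Proof.
move=> /env_homogP hu /env_homogP hv; apply/env_homogP => c ca.
by rewrite mcoeffD hu // hv // addr0.
Qed.

Lemma env_homogZ a k u : env_homog a u -> env_homog a (k *: u).
Proof.
move=> /env_homogP hu; apply/env_homogP => c ca.
by rewrite mcoeffZ hu // mulr0.
Qed.

Lemma env_homog_sum a (I : eqType) (r : seq I) (F : I -> tensor) :
  (forall i, i \in r -> env_homog a (F i)) -> env_homog a (\sum_(i <- r) F i).
Proof.
move=> h; rewrite big_seq; elim/big_ind: _ => //; first exact: env_homog0.
exact: env_homogD.
Qed.

Lemma env_homogU c : env_homog (envdeg c) << c >>.
Proof. by move=> k /(fsubsetP msuppU_le); rewrite in_fset1 => /eqP ->. Qed.

Lemma deg_vx (z : P) : (z <= x)%O ->
  deg z = \sum_(i : vx | val i \in supp z) delta_mx 0 (val i).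
Proof.
move=> zx; rewrite /deg -(big_sub_cond (mem (supp x)) (fun i => i \in supp z)
  (fun i => delta_mx 0 i)) /=.
apply: eq_bigl => i; rewrite !inE; case iz: (_ <= z)%O; rewrite ?andbF //.
by rewrite (le_trans iz zx).
Qed.

Lemma lopt_deg (z : P) c c' : lopt z c = Some c' -> envdeg c' = envdeg c + deg z.
Proof.
rewrite /lopt; case: ifP => // zx [<-]; rewrite /envdeg /= (deg_vx zx).
rewrite addrAC; congr (_ + _); rewrite [X in _ = _ + X]big_mkcond -big_split /=.
apply: eq_bigr => i _; rewrite !ffunE mulrzDr; congr (_ + _).
by case: (val i \in supp z).
Qed.

Lemma iopt_deg (z : pstar P) c c' :
  iopt z c = Some c' -> envdeg c' = envdeg c + deg (val z).
Proof.
rewrite /iopt; case: insubP => // w _ wz; case: ifP => // cw [<-].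
rewrite /envdeg /= -addrA; congr (_ + _).
rewrite (bigD1 w) //= [in RHS](bigD1 w) //= ffunE eqxx wz.
rewrite (eq_bigr (fun v => deg (val (val v)) *+ c.2 v)) => [|v /negbTE vw].
  rewrite -{2}(subnK cw) mulrnDr mulr1n !opprD addrAC; congr (_ + _).
  by rewrite addrNK.
by rewrite ffunE vw subn0.
Qed.

Lemma partial_act_homog f a b e :
  (forall c c', f c = Some c' -> envdeg c' = envdeg c + b) ->
  env_homog a e -> env_homog (a + b) (partial_act f e).
Proof.
move=> fb ea; apply: env_homog_sum => c /ea <-; apply: env_homogZ.
by case fc: (f c) => [c'|]; [rewrite -(fb _ _ fc); exact: env_homogU
                            | exact: env_homog0].
Qed.

Lemma env_act_homog z a e :
  env_homog a e -> env_homog (a + deg (val z)) (env_act z e).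
Proof.
move=> ea; rewrite env_actE; apply: env_homogD; apply: partial_act_homog => //.
  exact: lopt_deg.
exact: iopt_deg.
Qed.

Lemma monact_homog m a e :
  env_homog a e -> env_homog (a + mondeg m) (monact env_act m e).
Proof.
move=> ea; rewrite /mondeg /monact -big_enum /=.
elim: (enum _) => [|z s IHs]; first by rewrite big_nil addr0.
rewrite big_cons /= [deg _ *+ _ + _]addrC addrA.
elim: (m z) => [|n IHn]; first by rewrite addr0.
by rewrite mulrSr addrA; exact: env_act_homog.
Qed.

Lemma env_is_grading : @is_grading K d P env env_homog.
Proof.
split.
- exact: env_homog0.
- move=> a u v ua va; apply: env_homogD => //.
  by have := env_homogZ (k := -1) va; rewrite scaleN1r.
- move=> a b p u pa ub; apply: env_homog_sum => m /pa <-; apply: env_homogZ.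
  by rewrite addrC; exact: monact_homog.
- move=> u; exists (undup [seq envdeg c | c <- msupp u]).
  exists (fun a => \sum_(c <- msupp u | envdeg c == a) (u : tensor)@_c *: << c >>).
  split=> [a|].
    rewrite -big_filter; apply: env_homog_sum => c.
    by rewrite mem_filter => /andP[/eqP <- _]; apply/env_homogZ/env_homogU.
  rewrite {1}[u]malg_basis (exchange_big_dep predT) //=.
  apply: eq_big_seq => c cu; rewrite -big_filter.
  have -> : [seq a <- undup [seq envdeg c | c <- msupp u] | envdeg c == a]
            = [:: envdeg c].
    rewrite (@eq_filter _ _ (pred1 (envdeg c))) => [|a]; last exact: eq_sym.
    by rewrite filter_pred1_uniq ?undup_uniq // mem_undup map_f.
  by rewrite big_seq1.
- move=> s c us hc s0 a sa; apply/malgP => k; rewrite mcoeff0.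
  have [ka|/(proj1 (env_homogP _ _) (hc a))//] := eqVneq (envdeg k) a.
  have := congr1 (mcoeff k) s0; rewrite mcoeff0 raddf_sum (bigD1_seq a) //=.
  rewrite big1 ?addr0 // => b ba.
  by apply: (proj1 (env_homogP _ _) (hc b)); rewrite ka eq_sym.
Qed.

Definition Ex : grmod K P := GrMod env_is_grading.

(* K[t_i | i in supp x] \otimes 1 *)
Definition Sx_sub (e : Ex) : Prop :=
  exists u : polyx, e = tens (poly_laurent u) one_inv.

Definition px : {pred S} := fun p => `[< prime_ideal x p >].

Lemma ideal_gen0 (G : S -> Prop) : ideal_gen G 0.
Proof. by exists [::]; rewrite ?big_nil. Qed.

Lemma ideal_genD (G : S -> Prop) p q :
  ideal_gen G p -> ideal_gen G q -> ideal_gen G (p + q).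
Proof.
move=> [s sG ->] [t tG ->]; exists (s ++ t); last by rewrite big_cat.
by move=> c; rewrite mem_cat => /orP[/sG|/tG].
Qed.

Lemma ideal_genM (G : S -> Prop) r p : ideal_gen G p -> ideal_gen G (r * p).
Proof.
move=> [s sG ->]; exists [seq (r * c.1, c.2) | c <- s].
  by move=> _ /mapP[c /sG cG ->].
by rewrite big_map mulr_sumr; apply: eq_bigr => c _; rewrite mulrA.
Qed.

Lemma pxM r p : p \in px -> r * p \in px.
Proof.
move=> /asboolP[q [i [-> fi vq]]]; apply/asboolP; exists (r * q), (r * i).
by split; [rewrite mulrDr | exact: ideal_genM | exact: ideal_genM].
Qed.

Lemma px_zmod_closed : zmod_closed px.
Proof.
split=> [|p q pp qp].
  by apply/asboolP; exists 0, 0; split; rewrite ?addr0 //; exact: ideal_gen0.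
have /asboolP[q1 [q2 [qE i2 i1]]] : -1 * q \in px by exact: pxM.
rewrite -mulN1r qE; move/asboolP: pp => [p1 [p2 [-> k2 k1]]].
apply/asboolP; exists (p1 + q1), (p2 + q2).
by split; [rewrite addrACA | exact: ideal_genD | exact: ideal_genD].
Qed.

HB.instance Definition _ := GRing.isZmodClosed.Build S px px_zmod_closed.

Definition Sx : Type := Quotient.quot px.
HB.instance Definition _ := GRing.Zmodule.on Sx.

Definition Sx_pi (p : S) : Sx := \pi_(Quotient.quot px) p.

Definition Sx_scale (p : S) (u : Sx) : Sx := Sx_pi (p * repr (u : Quotient.quot px)).

Lemma Sx_piP p q : Sx_pi p = Sx_pi q <-> p - q \in px.
Proof. by rewrite Quotient.idealrBE; split=> [/eqP|/eqP]. Qed.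

Lemma Sx_piK u : Sx_pi (repr (u : Quotient.quot px)) = u.
Proof. exact: reprK. Qed.

Lemma Sx_piD p q : Sx_pi (p + q) = Sx_pi p + Sx_pi q.
Proof. exact: (raddfD (\pi_(Quotient.quot px))). Qed.

Lemma Sx_scale_pi p q : Sx_scale p (Sx_pi q) = Sx_pi (p * q).
Proof. by apply/Sx_piP; rewrite -mulrBr; apply/pxM/Sx_piP/Sx_piK. Qed.

Lemma Sx_scaleA p q u : Sx_scale p (Sx_scale q u) = Sx_scale (p * q) u.
Proof. by rewrite -[u]Sx_piK !Sx_scale_pi mulrA. Qed.

Lemma Sx_scale1 : left_id 1 Sx_scale.
Proof. by move=> u; rewrite -[u]Sx_piK Sx_scale_pi mul1r. Qed.

Lemma Sx_scaleDr : right_distributive Sx_scale +%R.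
Proof.
move=> p u v; rewrite -[u]Sx_piK -[v]Sx_piK -Sx_piD !Sx_scale_pi -Sx_piD.
by rewrite mulrDr.
Qed.

Lemma Sx_scaleDl u : {morph Sx_scale^~ u : p q / p + q}.
Proof.
by move=> p q; rewrite -[u]Sx_piK !Sx_scale_pi -Sx_piD mulrDl.
Qed.

HB.instance Definition _ := GRing.Zmodule_isLmodule.Build S Sx
  Sx_scaleA Sx_scale1 Sx_scaleDr Sx_scaleDl.

End Envelope.

Arguments Sx_pi {K d P} x p.
Arguments Sx_sub K {d P} x e.

(* Main.v *)
Require Import Defs.
From HB Require Import structures.
From mathcomp Require Import all_boot all_order all_algebra.
From mathcomp Require Import finmap boolp monalg.
From mathcomp Require classical_sets.

Set Implicit Arguments.
Unset Strict Implicit.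
Unset Printing Implicit Defensive.

Import Order.TTheory GRing.Theory.

Local Open Scope ring_scope.

(** Write t_i for the variables of the vertices of x and, for every other w in
    P^*, replace t_w by s_w = t_w - \prod_i t_i (i in supp w) if w <= x and by
    s_w = t_w otherwise. This is a homogeneous change of variables of S. On E_x
    each t_i only shifts the Laurent factor and each s_w only lowers the inverse
    system, so E_x is K[t_i^{+-1}] tensor K[s_w^{-1}] over K[t_i, s_w], without
    any interaction between the two factors.

    Injectivity. By Zorn's lemma and the usual argument of Baer
    (baer_star_injective), it is enough to show that a homomorphism of degree mu
    from an ideal of S to E_x is multiplication by an element of degree mu on
    homogeneous elements (Ex_baer, from baer_extension). Every element of E_x is
    killed by a power of each s_w. As S is noetherian (malg_noetherian, from the
    basis theorem), the homomorphism f vanishes on the multiples of a power of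
    s_w that lie in its domain, and so extends by 0 to that power
    (torsion_vanish, torsion_extend); after doing this for all w, the domain
    contains s_w^N for all w. An element of E_x of known degree is determined by
    the residues of its multiples, where the residue sets all t_i to 1 and takes
    the coefficient of the empty monomial of the inverse system. The residue of
    f(p), for p homogeneous of a degree where it can be nonzero, depends only on
    the class of p modulo the s_w^N and the t_i - 1, which lies in a
    finite-dimensional space; a linear functional on that space extending it
    (functional_coordinates) gives the coefficients of the required element.

    Essentiality. A homogeneous u != 0 is multiplied by a monomial s^b, b maximal
    in its support, which leaves a single Laurent monomial, and then by a
    monomial in the t_i that makes the exponents nonnegative (Sx_essential).

    The submodule S_x. On 1 tensor 1 an element p of S acts as its image under
    pi_x (poly_env_pi), so K[t_i] tensor 1 is the cyclic module generated by
    1 tensor 1, and its annihilator has to be compared with p_x. The face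
    relations act as 0 because the vertices of y and z, with multiplicity, are
    those of their meet and of their join below x (px_ann). Conversely all s_w
    are in p_x, for w <= x by induction on its number of vertices; so modulo p_x
    every element is a polynomial in the t_i, on which pi_x is injective
    (px_monomial, ann_px). *)

(** * Modules and ideals *)

Lemma subrDD (V : zmodType) (p q r s : V) : (p + q) - (r + s) = (p - r) + (q - s).
Proof. by rewrite opprD addrACA. Qed.

Lemma scale_swap (R : comPzRingType) (V : lmodType R) (p q : R) (v : V) :
  p *: (q *: v) = q *: (p *: v).
Proof. by rewrite !scalerA mulrC. Qed.

Lemma scale_subM (R : pzRingType) (V : lmodType R) (a b c r : R) (v : V) :
  (a * b - c * r) *: v = a *: (b *: v) - c *: (r *: v).
Proof. by rewrite scalerBl !scalerA. Qed.

Lemma scale_exprS_mul (R : pzRingType) (V : lmodType R) (a r : R) k (v : V) :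
  a *: ((a ^+ k * r) *: v) = (a ^+ k.+1 * r) *: v.
Proof. by rewrite scalerA exprS mulrA. Qed.

Lemma scale_algA (F : fieldType) (A : comAlgType F) (V : lmodType A) (c : F) (p : A) (v : V) :
  (c *: p) *: v = c%:A *: (p *: v).
Proof. by rewrite scalerA mulr_algl. Qed.

Lemma scaler_subA (F : fieldType) (A : comAlgType F) (c : F) (p q : A) :
  c *: p - c *: q = c%:A * (p - q).
Proof. by rewrite mulr_algl scalerBr. Qed.

Lemma linear_bundle (R : pzRingType) (U V : lmodType R) (f : U -> V) :
  linear f -> exists g : {linear U -> V}, forall u, g u = f u.
Proof.
move=> lf; pose fL := GRing.isLinear.Build R U V *:%R f lf.
by exists (HB.pack_for (GRing.Linear.type _ _) f fL).
Qed.

Lemma max_in_seq (T : eqType) (s : seq T) (f : T -> nat) (c0 : T) : c0 \in s ->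
  exists2 c, c \in s & forall c', c' \in s -> (f c' <= f c)%N.
Proof.
elim: s c0 => // c1 s IHs c0 _.
have [->|[c2 c2s]] : s = [::] \/ exists c2, c2 \in s.
- by case: s {IHs} => [|c2 s]; [left|right; exists c2; rewrite mem_head].
- by exists c1; rewrite ?mem_head // => c'; rewrite inE => /eqP ->.
have [c cs cmax] := IHs _ c2s.
have [le|lt] := leqP (f c1) (f c).
  exists c => [|c']; rewrite inE ?cs ?orbT // => /orP[/eqP -> //|]; exact: cmax.
exists c1 => [|c']; rewrite ?mem_head // inE => /orP[/eqP -> //|/cmax le].
exact: leq_trans le (ltnW lt).
Qed.

Definition submodule (R : pzRingType) (V : lmodType R) (N : V -> Prop) : Prop :=
  [/\ N 0, forall u v, N u -> N v -> N (u + v)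
    & forall r u, N u -> N (r *: u)].

Definition ideal (R : comNzRingType) (I : R -> Prop) : Prop :=
  [/\ I 0, forall a b, I a -> I b -> I (a + b) & forall r a, I a -> I (r * a)].

Lemma idealB (R : comNzRingType) (I : R -> Prop) a b :
  ideal I -> I a -> I b -> I (a - b).
Proof. by case=> _ ID IM Ia Ib; apply: ID => //; rewrite -mulN1r; apply: IM. Qed.

Lemma idealI (T : comNzRingType) (I J : T -> Prop) :
  ideal I -> ideal J -> ideal (fun a => I a /\ J a).
Proof.
move=> [I0 ID IM] [J0 JD JM]; split=> // [a b [Ia Ja] [Ib Jb]|r a [Ia Ja]].
  by split; [apply: ID|apply: JD].
by split; [apply: IM|apply: JM].
Qed.

Lemma ann_ideal (R : comNzRingType) (V : lmodType R) (v : V) :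
  ideal (fun p : R => p *: v = 0).
Proof.
split=> [|p q pv qv|r p pv]; first exact: scale0r.
  by rewrite scalerDl pv qv addr0.
by rewrite -scalerA pv scaler0.
Qed.

Lemma ideal_gen_ind (K : fieldType) (d : Order.disp_t) (P : finBPOrderType d)
    (G I : polyS K P -> Prop) : ideal I ->
  (forall g, G g -> I g) -> forall p, ideal_gen G p -> I p.
Proof.
move=> [I0 ID IM] GI p [s sG ->]; rewrite big_seq.
by elim/big_ind: _ => // c /sG/GI; exact: IM.
Qed.

Lemma ideal_gen_mem (K : fieldType) (d : Order.disp_t) (P : finBPOrderType d)
    (G : polyS K P -> Prop) g : G g -> ideal_gen G g.
Proof.
move=> Gg; exists [:: (1, g)] => [c|]; first by rewrite inE => /eqP ->.
by rewrite big_seq1 mul1r.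
Qed.

(** * Noetherian rings *)

(** Finite generation is phrased through all the ideals containing the
    generators, so that no linear combination has to be manipulated. *)
Definition noetherian (R : comNzRingType) : Prop :=
  forall I : R -> Prop, ideal I ->
    exists2 s : seq R, (forall a, a \in s -> I a) &
      forall J : R -> Prop, ideal J -> (forall a, a \in s -> J a) ->
        forall a, I a -> J a.

Lemma field_noetherian (K : fieldType) : noetherian K.
Proof.
move=> I [I0 ID IM].
have [[a [Ia a0]]|no] := pselect (exists a, I a /\ a != 0).
  exists [:: a]; first by move=> b; rewrite inE => /eqP ->.
  move=> J [_ _ JM] Ja b _; rewrite -[b](divfK a0); apply: JM.
  by apply: Ja; rewrite inE.
exists [::] => // J [J0 _ _] _ a Ia.
by have [->//|a0] := eqVneq a 0; case: no; exists a.
Qed.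

Lemma noetherian_surj (R R' : comNzRingType) (f : {rmorphism R -> R'}) :
  noetherian R -> (forall b, exists a, b = f a) -> noetherian R'.
Proof.
move=> noeR f_surj I [I0 ID IM].
have [|s sI sgen] := noeR (fun a => I (f a)).
  split=> [|a b Ia Ib|r a Ia]; first by rewrite rmorph0.
    by rewrite rmorphD; apply: ID.
  by rewrite rmorphM; apply: IM.
exists (map f s) => [_ /mapP[a /sI Ia ->] //|J [J0 JD JM] sJ b Ib].
have [a ba] := f_surj b; rewrite ba in Ib *.
apply: (sgen (fun a => J (f a))) => // [|c cs]; last by apply: sJ; apply: map_f.
split=> [|c c' Jc Jc'|r c Jc]; first by rewrite rmorph0.
  by rewrite rmorphD; apply: JD.
by rewrite rmorphM; apply: JM.
Qed.

Section Hilbert.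
Variables (R : comNzRingType) (noeR : noetherian R).

(** Polynomials of degree less than n are included, which makes this an ideal. *)
Definition lead_ideal (J : {poly R} -> Prop) (n : nat) (a : R) : Prop :=
  exists f, [/\ J f, (size f <= n.+1)%N & f`_n = a].

Lemma lead_ideal_ideal J n : ideal J -> ideal (lead_ideal J n).
Proof.
move=> [J0 JD JM]; split=> [|a b [f [Jf sf <-]] [g [Jg sg <-]]|r a [f [Jf sf <-]]].
- by exists 0; rewrite size_poly0 coef0.
- exists (f + g); rewrite coefD; split=> //; first exact: JD.
  by rewrite (leq_trans (size_polyD _ _)) // geq_max sf.
- exists (r%:P * f); rewrite coefCM; split=> //; first exact: JM.
  by rewrite mul_polyC (leq_trans (size_scale_leq _ _)).
Qed.

Lemma lead_ideal_le J m n a : ideal J -> (m <= n)%N ->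
  lead_ideal J m a -> lead_ideal J n a.
Proof.
move=> [J0 JD JM] mn [f [Jf sf <-]]; exists ('X^(n - m) * f); split.
- exact: JM.
- rewrite (leq_trans (size_polyMleq _ _)) // size_polyXn addSn /=.
  by rewrite (leq_trans (leq_add (leqnn _) sf)) // addnS subnK.
- by rewrite coefXnM ltnNge leq_subr /= subKn.
Qed.

Lemma lead_ideal_union_ideal J : ideal J -> ideal (fun a => exists n, lead_ideal J n a).
Proof.
move=> idJ; split=> [|a b [m am] [n bn]|r a [n an]].
- by exists 0%N; case: (lead_ideal_ideal 0 idJ).
- exists (maxn m n); case: (lead_ideal_ideal (maxn m n) idJ) => _ + _; apply.
    exact: lead_ideal_le (leq_maxl _ _) am.
  exact: lead_ideal_le (leq_maxr _ _) bn.
- by exists n; case: (lead_ideal_ideal n idJ) => _ _; apply.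
Qed.

(** Subtracting from f an element of I and J with the same leading term lowers
    the degree. *)
Lemma lead_ideal_sub (I J : {poly R} -> Prop) : ideal I -> ideal J ->
  (forall n a, lead_ideal I n a -> lead_ideal (fun f => I f /\ J f) n a) ->
  forall f, I f -> J f.
Proof.
move=> idI [J0 JD JM] IJ f.
have [n] := ubnP (size f); elim: n f => // n IHn f; rewrite ltnS => sf If.
case: n IHn sf => [_|n IHn sf].
  by rewrite leqn0 size_poly_eq0 => /eqP ->.
have [g [[Ig Jg] sg gf]] : lead_ideal (fun f => I f /\ J f) n f`_n.
  by apply: IJ; exists f.
rewrite -[f](subrK g); apply: JD => //; apply: IHn; last exact: idealB.
apply/leq_sizeP => j; rewrite leq_eqVlt => /orP[/eqP <-|nj].
  by rewrite coefB gf subrr.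
by rewrite coefB !nth_default ?subrr // (leq_trans _ nj).
Qed.

(** The leading coefficients of I form an ascending chain of ideals of R, which
    is constant from some degree d on; polynomials of degree at most d that
    realize generators of the ideals up to d generate I. *)
Theorem hilbert_basis : noetherian {poly R}.
Proof.
move=> I idI.
have [sL sLI sLgen] := noeR (lead_ideal_union_ideal idI).
have [d sLd] : exists d, forall a, a \in sL -> lead_ideal I d a.
  elim: sL sLI {sLgen} => [|a s IHs] sI; first by exists 0%N.
  have [|d sd] := IHs; first by move=> b bs; apply: sI; rewrite inE bs orbT.
  have [n an] := sI a (mem_head _ _).
  exists (maxn n d) => b; rewrite inE => /orP[/eqP ->|/sd bd].
    exact: lead_ideal_le (leq_maxl _ _) an.
  exact: lead_ideal_le (leq_maxr _ _) bd.
have lead_d n a : lead_ideal I n a -> lead_ideal I d a.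
  by move=> an; apply: (sLgen (lead_ideal I d)) => //;
    [exact: lead_ideal_ideal|exists n].
(* T realizes, degree by degree, generators of the finitely many ideals of
   leading coefficients that precede the stable one *)
have [T TI Tgen] : exists2 T : seq {poly R}, (forall f, f \in T -> I f) &
    forall J : {poly R} -> Prop, ideal J -> (forall f, f \in T -> J f) ->
    forall n a, (n < d.+1)%N -> lead_ideal I n a ->
    lead_ideal (fun f => I f /\ J f) n a.
  elim: d.+1 => [|m [T TI Tgen]]; first by exists [::].
  have [s sI sgen] := noeR (lead_ideal_ideal m idI).
  have [U UI Ugen] : exists2 U : seq {poly R}, (forall f, f \in U -> I f) &
      forall J : {poly R} -> Prop, (forall f, f \in U -> J f) ->
      forall a, a \in s -> lead_ideal (fun f => I f /\ J f) m a.
    elim: s sI {sgen} => [|a s IHs] sI; first by exists [::].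
    have [|U UI Ugen] := IHs; first by move=> b bs; apply: sI; rewrite inE bs orbT.
    have [f [If sf fa]] := sI a (mem_head _ _).
    exists (f :: U) => [g|J UJ b]; rewrite inE => /orP[/eqP ->|] //; first exact: UI.
      by exists f; split => //; split => //; apply: UJ; rewrite mem_head.
    by apply: Ugen => g gU; apply: UJ; rewrite inE gU orbT.
  exists (T ++ U) => [f|J idJ TUJ n a].
    by rewrite mem_cat => /orP[/TI|/UI].
  have TJ f : f \in T -> J f by move=> fT; apply: TUJ; rewrite mem_cat fT.
  have UJ f : f \in U -> J f by move=> fU; apply: TUJ; rewrite mem_cat fU orbT.
  rewrite ltnS leq_eqVlt => /orP[/eqP ->|nm]; last exact: Tgen.
  apply: (sgen (lead_ideal (fun f => I f /\ J f) m)).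
    exact: lead_ideal_ideal (idealI idI idJ).
  exact: Ugen.
exists T => // J idJ TJ; apply: lead_ideal_sub => // n a an.
have [nd|dn] := ltnP n d.+1; first exact: Tgen.
apply: (lead_ideal_le (idealI idI idJ) (ltnW dn)).
by apply: Tgen => //; exact: lead_d an.
Qed.

End Hilbert.

Lemma malgUM (K : fieldType) (I : choiceType) (m k : {cmonom I}) :
  << mmul m k >> = << m >> * << k >> :> {malg K[{cmonom I}]}.
Proof. by rewrite malgM_def fgmulUU mulr1. Qed.

Lemma malg_monomE (K : fieldType) (I : finType) (m : {cmonom I}) :
  << m >> = \prod_(i : I) << ucm i >> ^+ m i :> {malg K[{cmonom I}]}.
Proof.
pose h (k : {cmonom I}) : {malg K[{cmonom I}]} := << k >>.
have hX k n : h k ^+ n = h (iter n (mmul k) mone).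
  elim: n => [|n IHn]; first exact: expr0.
  rewrite exprS IHn /h -malgUM iterS; exact: erefl.
under eq_bigr do rewrite -/(h _) hX.
rewrite -(big_morph h (malgUM K (I := I)) erefl).
congr << _ >>; apply/eqP/cmP => j.
rewrite (big_morph (fun k : {cmonom I} => k j) (fun k l => cmM j k l) (cm1 j)).
have iterE i n : iter n (mmul (ucm i)) mone j = (n * (i == j))%N.
  by elim: n => [|n IHn] /=; rewrite ?cm1 // cmM IHn cmU mulSn.
under eq_bigr do rewrite iterE.
rewrite (bigD1 j) //= eqxx muln1 big1 ?addn0 // => i /negbTE ->.
by rewrite muln0.
Qed.

(** A polynomial ring in finitely many variables is reached from the field of
    constants by adjoining one variable at a time, so it is a quotient of an
    iterated univariate polynomial ring. *)
Theorem malg_noetherian (K : fieldType) (I : finType) :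
  noetherian {malg K[{cmonom I}]}.
Proof.
have [R [noeR [f [fC fX]]]] : exists R : comNzRingType, noetherian R /\
    exists f : {rmorphism R -> {malg K[{cmonom I}]}},
    (forall c : K, exists a, c%:MP = f a) /\
    (forall i, i \in enum I -> exists a, << ucm i >> = f a).
  elim: (enum I) => [|i s [R [noeR [f [fC fX]]]]].
    exists K; split; first exact: field_noetherian.
    by exists (malgC : {rmorphism K -> {malg K[{cmonom I}]}}); split=> // c; exists c.
  exists {poly R}; split; first exact: hilbert_basis.
  have cfu : commr_rmorph f << ucm i >> by move=> a; exact: mulrC.
  exists (horner_morph cfu); split=> [c|j].
    by have [a ->] := fC c; exists a%:P; rewrite /= horner_morphC.
  rewrite inE => /orP[/eqP ->|/fX[a ->]].
    by exists 'X; rewrite /= horner_morphX.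
  by exists a%:P; rewrite /= horner_morphC.
apply: (noetherian_surj (f := f)) => // p.
have fM a b : (exists r, a = f r) -> (exists r, b = f r) -> exists r, a * b = f r.
  by move=> [r ->] [r' ->]; exists (r * r'); rewrite rmorphM.
have f1 : exists r, 1 = f r by exists 1; rewrite rmorph1.
rewrite [p]malg_basis; elim/big_ind: _ => [|a b [r ->] [r' ->]|m _].
- by exists 0; rewrite rmorph0.
- by exists (r + r'); rewrite rmorphD.
rewrite -mul_malgC; apply: (fM); first exact: fC.
suff -> : << m >> = \prod_(i : I) << ucm i >> ^+ m i :> {malg K[{cmonom I}]}.
  elim/big_ind: _ => [|a b fa fb|i _]; [exact: f1|exact: fM|].
  elim: (m i) => [|n IHn]; first by rewrite expr0; exact: f1.
  by rewrite exprS; apply: (fM); [apply: fX; rewrite mem_enum|exact: IHn].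
exact: malg_monomE.
Qed.

(** * Lower intervals of a simplicial poset *)

Section Simplicial.
Variables (d : Order.disp_t) (P : finBPOrderType d).
Implicit Types x y z w : P.

Lemma boolean_of_rankP x r : boolean_of_rank x r ->
  exists (g : P -> {set 'I_r}) (h : {set 'I_r} -> P),
    [/\ forall A, (h A <= x)%O, cancel h g,
        forall y, (y <= x)%O -> h (g y) = y
      & forall y z, (y <= x)%O -> (z <= x)%O -> (g y \subset g z) = (y <= z)%O].
Proof.
move=> /existsP[f /and3P[/injectiveP f_inj /forallP f_surj f_mono]].
pose T := {y : P | (y <= x)%O}.
pose g y : {set 'I_r} := if insub y is Some u then f (u : T) else set0.
have gE (u : T) : g (val u) = f u by rewrite /g valK.
have fx A : exists u, f u = A by have /codomP[u ->] := f_surj A; exists u.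
pose h A := val (sval (cid (fx A))).
have fh A : g (h A) = A by rewrite /h gE; case: cid.
exists g, h; split=> [A||y yx|y z yx zx].
- exact: (valP (sval (cid (fx A)))).
- exact: fh.
- rewrite /h; case: cid => u /=; rewrite -[in g y](SubK T yx) gE => /f_inj ->.
  exact: SubK.
- rewrite -{1}(SubK T yx) -{1}(SubK T zx) !gE.
  by have /forallP/(_ (Sub y yx))/forallP/(_ (Sub z zx))/eqP -> := f_mono; rewrite !SubK.
Qed.

(** A boolean algebra of rank 1 has two elements. *)
Lemma rank1P y : y \in rank1 P <->
  y != \bot%O /\ forall z, (z <= y)%O -> z = \bot%O \/ z = y.
Proof.
rewrite inE; split=> [/boolean_of_rankP[g [h [hy hK gK g_mono]]]|[y0 atom]].
  have gbot : g \bot%O = set0.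
    apply/eqP; rewrite -subset0 -(hK set0).
    by rewrite g_mono ?le0x.
  have gy : g y = setT.
    by apply/eqP; rewrite -subTset -(hK setT) g_mono.
  split=> [|z zy].
    apply: contra_eq_neq gy => ->; rewrite gbot eq_sym.
    by apply/set0Pn; exists ord0; rewrite inE.
  have [/eqP|[i iz]] := set_0Vmem (g z).
    by rewrite -gbot => /eqP e; left; rewrite -(gK z zy) e gK ?le0x.
  right; rewrite -(gK z zy) -(gK y) // gy; congr h.
  by apply/eqP; rewrite -subTset; apply/subsetP => j _; rewrite [j]ord1 -(ord1 i).
apply/existsP; exists [ffun u => if val u == \bot%O then set0 else setT].
have T0 : setT != set0 :> {set 'I_1}.
  by apply/set0Pn; exists ord0; rewrite inE.
apply/and3P; split.
- apply/injectiveP => u v; rewrite !ffunE.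
  case: (atom _ (valP u)) (atom _ (valP v)) => eu [] ev.
  + by move=> _; apply: val_inj; rewrite eu ev.
  + by rewrite eu ev eqxx (negbTE y0) => /eqP; rewrite eq_sym (negbTE T0).
  + by rewrite eu ev eqxx (negbTE y0) => /eqP; rewrite (negbTE T0).
  + by move=> _; apply: val_inj; rewrite eu ev.
- apply/forallP => A; apply/codomP.
  have [->|[i iA]] := set_0Vmem A.
    by exists (exist _ \bot%O (le0x y)); rewrite ffunE eqxx.
  exists (exist _ y (lexx y)); rewrite ffunE /= (negbTE y0).
  by apply/eqP; rewrite -subTset; apply/subsetP => j _; rewrite [j]ord1 -(ord1 i).
- apply/forallP => u; apply/forallP => v; rewrite !ffunE.
  case: (atom _ (valP u)) => ->.
    by rewrite eqxx sub0set le0x.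
  rewrite (negbTE y0); case: (atom _ (valP v)) => ->.
    by rewrite eqxx subset0 (negbTE T0) lex0 (negbTE y0).
  by rewrite (negbTE y0) lexx subxx.
Qed.

Lemma vert_rank1 (i : 'I_(nvert P)) : vert i \in rank1 P.
Proof. exact: enum_valP. Qed.

Lemma vert_neq_bot (i : 'I_(nvert P)) : vert i != \bot%O.
Proof. by have [] := (rank1P _).1 (vert_rank1 i). Qed.

Lemma vert_surj y : y \in rank1 P -> exists i : 'I_(nvert P), vert i = y.
Proof. by move=> y1; exists (enum_rank_in y1 y); rewrite /vert enum_rankK_in. Qed.

Lemma supp_vert (i : 'I_(nvert P)) : supp (vert i) = [set i]%SET.
Proof.
apply/setP => j; rewrite !inE.
apply/idP/eqP => [ji|->//]; have [_ atom] := (rank1P _).1 (vert_rank1 i).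
by have [/eqP|/enum_val_inj //] := atom _ ji; rewrite (negbTE (vert_neq_bot j)).
Qed.

Lemma supp_bot : supp (\bot%O : P) = set0.
Proof. by apply/setP => j; rewrite !inE lex0 (negbTE (vert_neq_bot j)). Qed.

Lemma supp_mono y z : (y <= z)%O -> supp y \subset supp z.
Proof. by move=> yz; apply/subsetP => i; rewrite !inE => /le_trans; apply. Qed.

Hypothesis simpP : simplicial_poset P.

(** Both statements hold for the sets of atoms of a boolean algebra, and the
    vertices of x are the atoms of the interval below x. *)
Lemma supp_interval x :
  (forall y z, (y <= x)%O -> (z <= x)%O -> (supp y \subset supp z) = (y <= z)%O) /\
  (forall A : {set 'I_(nvert P)}, A \subset supp x -> exists2 y, (y <= x)%O & supp y = A).
Proof.
have [r /boolean_of_rankP[g [h [hx hK gK g_mono]]]] := simpP x.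
have h_mono A B : (h A <= h B)%O = (A \subset B) by rewrite -g_mono // !hK.
have gbot : g \bot%O = set0.
  by apply/eqP; rewrite -subset0 -(hK set0) g_mono ?le0x.
have atom k : h [set k]%SET \in rank1 P.
  apply/rank1P; split=> [|z zk].
    by apply/negP => /eqP e; have := congr1 g e; rewrite hK gbot => /setP/(_ k); rewrite !inE eqxx.
  have zx := le_trans zk (hx _).
  move: zk; rewrite -[z]gK // h_mono subset1 => /orP[/eqP ->|/eqP ->]; first by right.
  by left; rewrite -gbot gK ?le0x.
have vertE i : (vert i <= x)%O -> exists k, vert i = h [set k]%SET.
  move=> ix; have [vb va] := (rank1P _).1 (vert_rank1 i).
  have [e|[k ki]] := set_0Vmem (g (vert i)).
    by case/eqP: vb; rewrite -(gK _ ix) e -gbot gK ?le0x.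
  exists k; have : (h [set k]%SET <= vert i)%O.
    by rewrite -[vert i]gK // h_mono sub1set.
  case/va => // e; have := (rank1P _).1 (atom k); rewrite e eqxx; case=> //.
split=> [y z yx zx|A Ax].
  apply/idP/idP=> [/subsetP yz|]; last exact: supp_mono.
  rewrite -g_mono //; apply/subsetP => k ky; have [i ik] := vert_surj (atom k).
  have := yz i; rewrite !inE ik -{1}[y]gK // -{1}[z]gK // !h_mono !sub1set.
  exact.
exists (h [set k | h [set k]%SET \in [set vert i | i in A]]%SET) => //.
apply/setP => i; rewrite inE; apply/idP/idP => [ih|iA].
  have [k ik] := vertE i (le_trans ih (hx _)).
  by move: ih; rewrite ik h_mono sub1set inE -ik => /imsetP[j jA /enum_val_inj ->].
have ix : (vert i <= x)%O by move/subsetP: Ax => /(_ i iA); rewrite inE.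
have [k ik] := vertE i ix.
by rewrite ik h_mono sub1set inE -ik; apply/imsetP; exists i.
Qed.

Lemma supp_inj x y z : (y <= x)%O -> (z <= x)%O -> supp y = supp z -> y = z.
Proof.
move=> yx zx e; have [suppE _] := supp_interval x.
by apply/le_anti; rewrite -(suppE y z) // -(suppE z y) // e subxx.
Qed.

Lemma supp_pmeet x y z : (y <= x)%O -> (z <= x)%O ->
  (pmeet y z <= x)%O /\ supp (pmeet y z) = supp y :&: supp z.
Proof.
move=> yx zx; have [suppE supp_surj] := supp_interval x.
have [|m mx ms] := supp_surj (supp y :&: supp z).
  by rewrite (subset_trans _ (supp_mono yx)) // subsetIl.
have my : (m <= y)%O by rewrite -suppE // ms subsetIl.
have mz : (m <= z)%O by rewrite -suppE // ms subsetIr.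
have glb w : (w <= y)%O -> (w <= z)%O -> (w <= m)%O.
  move=> wy wz; rewrite -suppE ?(le_trans wy) // ms.
  by rewrite subsetI !supp_mono.
rewrite /pmeet; case: pickP => [w /and3P[wy wz /forallP gw]|/(_ m)]; last first.
  by rewrite my mz /= => /forallP[] w; apply/implyP => /andP[]; exact: glb.
suff -> : w = m by [].
by apply/le_anti; rewrite glb //=; have := gw m; rewrite my mz.
Qed.

Lemma joins_interval x y z : (y <= x)%O -> (z <= x)%O ->
  exists w, [/\ (w <= x)%O, supp w = supp y :|: supp z, w \in joins y z
    & forall w', w' \in joins y z -> (w' <= x)%O -> w' = w].
Proof.
move=> yx zx; have [suppE supp_surj] := supp_interval x.
have [|w wx ws] := supp_surj (supp y :|: supp z).
  by rewrite subUset !supp_mono.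
have yw : (y <= w)%O by rewrite -suppE // ws subsetUl.
have zw : (z <= w)%O by rewrite -suppE // ws subsetUr.
have lub u : (u <= x)%O -> (y <= u)%O -> (z <= u)%O -> (w <= u)%O.
  by move=> ux yu zu; rewrite -suppE // ws subUset !supp_mono.
exists w; split=> // [|w'].
  rewrite inE yw zw /=; apply/forallP => u; apply/implyP => /and3P[yu zu uw].
  by rewrite eq_le uw lub // (le_trans uw).
rewrite inE => /and3P[yw' zw' /forallP mw'] w'x; apply/esym/eqP.
by apply: (implyP (mw' w)); rewrite yw zw lub.
Qed.

End Simplicial.

(** * Homogeneous elements of the polynomial ring *)

Section Homogeneous.
Variables (K : fieldType) (d : Order.disp_t) (P : finBPOrderType d).
Local Notation S := (polyS K P).
Local Notation grade := 'rV[int]_(nvert P).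
Implicit Types (a b : grade) (p q : S).

Lemma mondegM (m k : {cmonom (pstar P)}) : mondeg (mmul m k) = mondeg m + mondeg k.
Proof. by rewrite /mondeg -big_split; apply: eq_bigr => z _; rewrite cmM mulrnDr. Qed.

Lemma mondeg1 : mondeg (mone : {cmonom (pstar P)}) = 0.
Proof. by rewrite /mondeg big1 // => z _; rewrite cm1. Qed.

Lemma homogSP a p : homogS a p <-> forall m, mondeg m != a -> p@_m = 0.
Proof.
split=> [h m|h m].
  by apply: contraNeq; rewrite mcoeff_neq0 => /h ->.
by rewrite -mcoeff_neq0; apply: contraNeq => /h ->; rewrite eqxx.
Qed.

Lemma homogS0 a : homogS a (0 : S).
Proof. by apply/homogSP => m _; rewrite mcoeff0. Qed.

Lemma homogSD a p q : homogS a p -> homogS a q -> homogS a (p + q).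
Proof.
move=> /homogSP hp /homogSP hq; apply/homogSP => m ma.
by rewrite mcoeffD hp // hq // addr0.
Qed.

Lemma homogSZ a (c : K) p : homogS a p -> homogS a (c *: p).
Proof. by move=> /homogSP hp; apply/homogSP => m ma; rewrite mcoeffZ hp // mulr0. Qed.

Lemma homogSB a p q : homogS a p -> homogS a q -> homogS a (p - q).
Proof. by move=> hp hq; rewrite -scaleN1r; apply: homogSD => //; exact: homogSZ. Qed.

Lemma homogSU (m : {cmonom (pstar P)}) : homogS (mondeg m) (<< m >> : S).
Proof. by move=> k /(fsubsetP msuppU_le); rewrite in_fset1 => /eqP ->. Qed.

Lemma homogS1 : homogS 0 (1 : S).
Proof. by rewrite -mondeg1; exact: homogSU. Qed.

Lemma homogSM a b p q : homogS a p -> homogS b q -> homogS (a + b) (p * q).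
Proof.
move=> hp hq m /msuppM_le[m1 [m2 [m1p m2q ->]]].
by rewrite mondegM (hp _ m1p) (hq _ m2q).
Qed.

Lemma homogSX a p n : homogS a p -> homogS (a *+ n) (p ^+ n).
Proof.
move=> hp; elim: n => [|n IHn]; first by rewrite expr0 mulr0n; exact: homogS1.
by rewrite exprS mulrS; exact: homogSM.
Qed.

Lemma homogS_prod (I : Type) (r : seq I) (Q : pred I) (F : I -> S) (g : I -> grade) :
  (forall i, Q i -> homogS (g i) (F i)) ->
  homogS (\sum_(i <- r | Q i) g i) (\prod_(i <- r | Q i) F i).
Proof.
move=> h; elim/big_rec2: _ => [|i a p Qi ap]; first exact: homogS1.
by apply: homogSM => //; exact: h.
Qed.

Lemma deg_vert (i : 'I_(nvert P)) : deg (vert i) = delta_mx 0 i.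
Proof. by rewrite /deg supp_vert big_set1. Qed.

Lemma deg_bot : deg (\bot%O : P) = 0.
Proof. by rewrite /deg supp_bot big_set0. Qed.

Lemma tvar_bot : tvar K (\bot%O : P) = 1.
Proof. by rewrite /tvar insubF ?eqxx. Qed.

Lemma homogS_tvar (z : P) : homogS (deg z) (tvar K z).
Proof.
rewrite /tvar; case: insubP => [u _ uz|]; last first.
  by rewrite negbK => /eqP ->; rewrite deg_bot; exact: homogS1.
suff -> : deg z = mondeg (ucm u) by exact: homogSU.
rewrite /mondeg (bigD1 u) //= cmUU uz big1 ?addr0 // => v.
by rewrite cmU eq_sym => /negbTE ->.
Qed.

End Homogeneous.

(** * New variables of the polynomial ring *)

Section Variables.
Variables (K : fieldType) (d : Order.disp_t) (P : finBPOrderType d) (x : P).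
Local Notation S := (polyS K P).
Local Notation E := (env K x).
Local Notation grade := 'rV[int]_(nvert P).
Implicit Types (n : {ffun vx x -> nat}) (b : iexp x) (a : lexp x).

Definition bas (c : lexp x * iexp x) : E :=
  (<< c >> : {malg K[(lexp x * iexp x)%type]}).

Definition tmon n : S := \prod_(i : vx x) tvar K (vert (val i)) ^+ n i.

(** For w <= x, t_w both shifts the Laurent factor and lowers the inverse system; the
    variable s_w = t_w - \prod_i t_i keeps only the second of these effects, so
    that E_x becomes a tensor product over two separate sets of variables. *)
Definition svar (w : pminus x) : S :=
  tvar K (val (val w)) -
    if (val (val w) <= x)%O then tmon [ffun i => (val i \in supp (val (val w)) : nat)]
    else 0.

Definition smon b : S := \prod_(w : pminus x) svar w ^+ b w.

Definition tsdeg n b : grade :=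
  \sum_(i : vx x) delta_mx 0 (val i) *+ n i + \sum_(w : pminus x) deg (val (val w)) *+ b w.

Lemma tmonD n n' : tmon n * tmon n' = tmon [ffun i => n i + n' i]%N.
Proof. by rewrite /tmon -big_split; apply: eq_bigr => i _; rewrite ffunE exprD. Qed.

Lemma smonD b b' : smon b * smon b' = smon [ffun w => b w + b' w]%N.
Proof. by rewrite /smon -big_split; apply: eq_bigr => i _; rewrite ffunE exprD. Qed.

Lemma tmon0 : tmon [ffun=> 0%N] = 1.
Proof. by rewrite /tmon big1 // => i _; rewrite ffunE expr0. Qed.

Lemma smon0 : smon [ffun=> 0%N] = 1.
Proof. by rewrite /smon big1 // => i _; rewrite ffunE expr0. Qed.

Lemma tmonU (i : vx x) : tmon [ffun j => (j == i : nat)] = tvar K (vert (val i)).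
Proof.
rewrite /tmon (bigD1 i) //= ffunE eqxx expr1 big1 ?mulr1 // => j /negbTE ji.
by rewrite ffunE ji expr0.
Qed.

Lemma smonX w k : smon [ffun v => ((v == w) * k)%N] = svar w ^+ k.
Proof.
rewrite /smon (bigD1 w) //= ffunE eqxx mul1n big1 ?mulr1 // => v /negbTE vw.
by rewrite ffunE vw expr0.
Qed.

Lemma smonU w : smon [ffun v => (v == w : nat)] = svar w.
Proof.
rewrite -[RHS]expr1 -smonX; congr smon; apply/ffunP => v.
by rewrite !ffunE muln1.
Qed.

Lemma tvarE (w : pminus x) : tvar K (val (val w)) = svar w +
  if (val (val w) <= x)%O then tmon [ffun i => (val i \in supp (val (val w)) : nat)]
    else 0.
Proof. by rewrite /svar subrK. Qed.

Lemma homogS_tmon n : homogS (\sum_(i : vx x) delta_mx 0 (val i) *+ n i) (tmon n).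
Proof.
by apply: homogS_prod => i _; apply: homogSX; rewrite -deg_vert; exact: homogS_tvar.
Qed.

Lemma homogS_svar w : homogS (deg (val (val w))) (svar w).
Proof.
apply: homogSB; first exact: homogS_tvar.
case: ifP => wx; last exact: homogS0.
rewrite (deg_vx wx) big_mkcond; set g := (X in homogS X).
suff -> : g = \sum_(i : vx x) delta_mx 0 (val i) *+ 
  [ffun i : vx x => (val i \in supp (val (val w)) : nat)] i by exact: homogS_tmon.
by apply: eq_bigr => i _; rewrite ffunE; case: ifP.
Qed.

Lemma homogS_smon b : homogS (\sum_(w : pminus x) deg (val (val w)) *+ b w) (smon b).
Proof. by apply: homogS_prod => w _; apply: homogSX; exact: homogS_svar. Qed.

Lemma tsdegDl n n' b : tsdeg [ffun i => n' i + n i]%N b =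
  tsdeg n b + \sum_(i : vx x) delta_mx 0 (val i) *+ n' i.
Proof.
rewrite /tsdeg [RHS]addrAC; congr (_ + _); rewrite -big_split.
by apply: eq_bigr => i _; rewrite ffunE addnC mulrnDr.
Qed.

Lemma tsdegDr n b b' : tsdeg n [ffun w => b' w + b w]%N =
  tsdeg n b + \sum_(w : pminus x) deg (val (val w)) *+ b' w.
Proof.
rewrite /tsdeg -[RHS]addrA; congr (_ + _); rewrite -big_split.
by apply: eq_bigr => w _; rewrite ffunE addnC mulrnDr.
Qed.

(** The span is the intersection of the subspaces containing it, so that a linear
    property of all homogeneous polynomials can be checked on monomials. *)
Definition spanned (dl : grade) (p : S) : Prop :=
  forall W : S -> Prop, submodule W ->
    (forall n b, tsdeg n b = dl -> W (tmon n * smon b)) -> W p.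

Lemma submodule_preim_mul (q : S) (W : S -> Prop) :
  submodule (W : {malg K[{cmonom (pstar P)}]} -> Prop) ->
  submodule (fun p : {malg K[{cmonom (pstar P)}]} => W (q * p)).
Proof.
move=> [W0 WD WZ]; split=> [|p p' Wp Wp'|c p Wp]; first by rewrite mulr0.
  by rewrite mulrDr; exact: WD.
by rewrite -scalerAr; exact: WZ.
Qed.

(** Multiplication by t_z turns t^n s^b into one or two monomials. *)
Lemma spanned_tvar dl (z : pstar P) p :
  spanned dl p -> spanned (dl + deg (val z)) (tvar K (val z) * p).
Proof.
move=> sp W Wsub Wts; apply: (sp (fun p => W (tvar K (val z) * p))).
  exact: submodule_preim_mul.
move=> n b nb; have [W0 WD WZ] := Wsub.
have [zx|zx] := boolP (val z \in [set vert i | i in supp x]).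
  have [i ix zi] := imsetP zx; pose j : vx x := Sub i ix.
  rewrite zi -[i]/(val j) -tmonU mulrA tmonD; apply: Wts.
  rewrite tsdegDl nb zi deg_vert; congr (_ + _).
  rewrite (bigD1 j) //= ffunE eqxx big1 ?addr0 // => k /negbTE kj.
  by rewrite ffunE kj.
pose w : pminus x := Sub z zx.
rewrite -[val z]/(val (val w)) tvarE mulrDl; apply: WD.
  rewrite -smonU mulrCA smonD; apply: Wts.
  rewrite tsdegDr nb; congr (_ + _).
  rewrite (bigD1 w) //= ffunE eqxx big1 ?addr0 // => k /negbTE kw.
  by rewrite ffunE kw.
case: ifP => wx; last by rewrite mul0r.
rewrite mulrA tmonD; apply: Wts; rewrite tsdegDl nb (deg_vx wx) [in RHS]big_mkcond.
by congr (_ + _); apply: eq_bigr => i _; rewrite ffunE; case: (_ \in _).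
Qed.

Lemma spanned_monomial (m : {cmonom (pstar P)}) : spanned (mondeg m) << m >>.
Proof.
rewrite malg_monomE /mondeg.
have -> : \prod_(z : pstar P) (<< ucm z >> : S) ^+ m z
          = \prod_(z : pstar P) tvar K (val z) ^+ m z.
  by apply: eq_bigr => z _; rewrite /tvar valK.
elim/big_rec2: _ => [|z p dl _ sp].
  move=> W Wsub Wts; rewrite -tmon0 -[tmon _]mulr1 -smon0; apply: Wts.
  by rewrite /tsdeg !big1 ?addr0 // => i _; rewrite ffunE.
elim: (m z) => [|k IHk]; first by rewrite expr0 mul1r add0r.
by rewrite exprS mulrSr addrAC -mulrA; exact: spanned_tvar.
Qed.

Lemma homogS_spanned dl (p : S) : homogS dl p -> spanned dl p.
Proof.
move=> hp W [W0 WD WZ] Wts; rewrite [p]malg_basis big_seq.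
elim/big_ind: _ => // m /hp mdl; apply: (WZ).
by apply: spanned_monomial => // n b nb; apply: Wts; rewrite nb.
Qed.

(** ** Their action on E_x *)

(** The action of S extends that of K on the basis of E_x. *)
Lemma env_constE (c : K) (e : E) :
  (c%:A : S) *: e = (c *: (e : {malg K[(lexp x * iexp x)%type]}) : E).
Proof.
change (polyact (env_act (K := K) (x := x)) (c *: << mone >>) e =
  c *: (e : {malg K[_]})).
by rewrite /polyact linearZ /= linextU monact1.
Qed.

Lemma env_basE (e : E) :
  e = \sum_(c <- msupp (e : {malg K[_]})) ((((e : {malg K[_]})@_c)%:A) : S) *: bas c.
Proof.
rewrite {1}[e]malg_basis; apply: eq_bigr => c _.
by rewrite env_constE.
Qed.

Lemma tvar_bas (z : pstar P) c : tvar K (val z) *: bas c =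
  (if lopt (val z) c is Some c' then bas c' else 0) +
  (if iopt z c is Some c' then bas c' else 0).
Proof. by rewrite env_scale_tvar env_actE /partial_act !linextU. Qed.

Lemma vert_bas (i : vx x) c :
  tvar K (vert (val i)) *: bas c = bas (c.1 + [ffun j => (j == i)%:Z], c.2).
Proof.
pose z : pstar P := Sub (vert (val i)) (vert_neq_bot _).
rewrite -[vert _]/(val z) tvar_bas /lopt /iopt.
have -> : (val z <= x)%O by have := valP i; rewrite inE.
rewrite insubF ?addr0; last by apply/negbF/imset_f; exact: valP.
rewrite /lexp_shift; set g := (X in c.1 + X); set h := (X in _ = bas (c.1 + X, _)).
suff -> : g = h by [].
by apply/ffunP => j; rewrite !ffunE supp_vert inE -(inj_eq val_inj).
Qed.

Lemma tmon_bas n c : tmon n *: bas c = bas (c.1 + [ffun i => (n i)%:Z], c.2).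
Proof.
have -> : [ffun i => (n i)%:Z] = \sum_(i : vx x) [ffun j => (j == i)%:Z] *+ n i :> lexp x.
  apply/ffunP => j; rewrite ffunE sum_ffunE (bigD1 j) //= big1 => [|i ij].
    by rewrite ffunMnE ffunE eqxx addr0 /= natz.
  by rewrite ffunMnE ffunE eq_sym (negbTE ij) mul0rn.
rewrite /tmon; elim/big_rec2: _ c => [|i a p _ IH] c.
  by rewrite scale1r addr0; case: c.
rewrite -scalerA IH; elim: (n i) => [|k IHk].
  by rewrite expr0 scale1r add0r.
by rewrite exprS -scalerA IHk vert_bas /= mulrSr -addrA [in LHS]addrAC.
Qed.

Lemma svar_bas w c :
  svar w *: bas c = if (0 < c.2 w)%N then bas (c.1, idec w c.2) else 0.
Proof.
rewrite scalerBl tvar_bas /iopt valK /lopt.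
case: ifP => wx; last by rewrite scale0r subr0 add0r; case: ifP.
rewrite tmon_bas; have -> : lexp_shift (val (val w)) c.1 =
    c.1 + [ffun i => [ffun i : vx x => (val i \in supp (val (val w)) : nat)] i : int].
  by congr (_ + _); apply/ffunP => i; rewrite !ffunE.
by rewrite addrAC subrr add0r; case: ifP.
Qed.

Lemma svarX_bas w k a b : svar w ^+ k *: bas (a, b) =
  if (k <= b w)%N then bas (a, [ffun v => b v - (v == w) * k]%N) else 0.
Proof.
elim: k => [|k IHk].
  by rewrite expr0 scale1r; congr bas; congr pair; apply/ffunP => v; rewrite ffunE muln0 subn0.
rewrite exprS -scalerA IHk; case: (leqP k (b w)) => kb; last first.
  by rewrite scaler0 leqNgt ltnW.
rewrite svar_bas /= ffunE eqxx mul1n subn_gt0; case: (k < b w)%N; last exact: erefl.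
congr bas; congr pair; apply/ffunP => v; rewrite !ffunE -subnDA.
by case: eqP => _; rewrite ?mul1n ?addn1.
Qed.

Lemma smon_bas b a b' : smon b *: bas (a, b') =
  if [forall w, b w <= b' w]%N then bas (a, [ffun w => b' w - b w]%N) else 0.
Proof.
have key (s : seq (pminus x)) : uniq s -> (\prod_(w <- s) svar w ^+ b w) *: bas (a, b') =
    if all (fun w => b w <= b' w)%N s then
      bas (a, [ffun w => b' w - (w \in s) * b w]%N) else 0.
  elim: s => [_|w s IHs /= /andP[ws us]].
    rewrite big_nil scale1r; congr bas; congr pair.
    by apply/ffunP => v; rewrite ffunE subn0.
  rewrite big_cons -scalerA IHs // andbC; case: ifP => _ /=; last by rewrite scaler0.
  rewrite svarX_bas ffunE (negbTE ws) subn0; case: (b w <= b' w)%N; last exact: erefl.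
  congr bas; congr pair; apply/ffunP => v; rewrite !ffunE -subnDA in_cons.
  have [->|vw] /= := eqVneq v w; first by rewrite (negbTE ws).
  by rewrite mul0n addn0.
rewrite /smon -big_enum key ?enum_uniq //=.
have -> : all (fun w => b w <= b' w)%N (enum (pminus x)) = [forall w, b w <= b' w]%N.
  apply/allP/forallP => [h w|h w _] //; first by apply: h; rewrite mem_enum.
case: [forall w, _]; last exact: erefl; congr bas; congr pair; apply/ffunP => w.
by rewrite !ffunE mem_enum mul1n.
Qed.

End Variables.

(** * Partial homomorphisms *)

(** A homomorphism defined on a submodule of U is handled as its graph, a
    submodule of U * V that meets 0 * V trivially; extending a homomorphism is
    then enlarging a submodule. *)
Definition linear_graph (R : pzRingType) (U V : lmodType R) (G : U -> V -> Prop) : Prop :=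
  [/\ G 0 0, forall u u' v v', G u v -> G u' v' -> G (u + u') (v + v')
    & forall r u v, G u v -> G (r *: u) (r *: v)].

Definition functional (R : pzRingType) (U V : lmodType R) (G : U -> V -> Prop) : Prop :=
  forall v, G 0 v -> v = 0.

Lemma linear_graphB (R : pzRingType) (U V : lmodType R) (G : U -> V -> Prop) u u' v v' :
  linear_graph G -> G u v -> G u' v' -> G (u - u') (v - v').
Proof.
move=> [_ GD GZ] uv uv'; apply: (GD) => //.
by rewrite -scaleN1r -[- v']scaleN1r; apply: GZ.
Qed.

Section Torsion.
Variables (R : comNzRingType) (V : lmodType R).
Hypothesis noeR : noetherian R.
Implicit Types (G : R^o -> V -> Prop) (s : R).

(** The increasing ideals (dom G : s^N) have a finitely generated union, so they
    are all contained in one (dom G : s^N); enlarging N, the values of G at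
    s^N times the generators are killed as well. *)
Lemma torsion_vanish G s : linear_graph G -> functional G ->
  (forall v : V, exists k, s ^+ k *: v = 0) ->
  exists M, forall r v, G (s ^+ M * r) v -> v = 0.
Proof.
move=> linG funG tors; have [G0 GD GZ] := linG.
have GM r a v : G a v -> G (r * a) (r *: v) by exact: GZ.
pose J r := exists N v, G (s ^+ N * r) v.
have idJ : ideal J.
  split=> [|a b [N [v Nv]] [N' [v' Nv']]|r a [N [v Nv]]].
  - by exists 0%N, 0; rewrite mulr0.
  - exists (N + N')%N, (s ^+ N' *: v + s ^+ N *: v').
    rewrite mulrDr; apply: (GD); first by rewrite addnC exprD -mulrA; exact: GM.
    by rewrite exprD -mulrA; exact: GM.
  - by exists N, (r *: v); rewrite mulrCA; exact: GM.
have [gs gsJ gen] := noeR idJ.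
have [M Mgs] : exists M, forall a, a \in gs -> G (s ^+ M * a) 0.
  elim: gs gsJ {gen} => [|a gs IH] gsJ; first by exists 0%N.
  have [|M HM] := IH; first by move=> b bgs; apply: gsJ; rewrite inE bgs orbT.
  have [N [v Nv]] := gsJ a (mem_head _ _); have [k kv] := tors v.
  exists (M + (k + N))%N => b; rewrite inE => /orP[/eqP ->|/HM].
    rewrite !exprD -!mulrA -[0](scaler0 _ (s ^+ M)); apply: (GM).
    by rewrite -kv; exact: GM.
  by rewrite addnC exprD -mulrA -{2}[0](scaler0 _ (s ^+ (k + N))); exact: GM.
exists M => r v rv; apply: funG.
have idM : ideal (fun a => G (s ^+ M * a) 0).
  split=> [|a b Ga Gb|c a Ga]; first by rewrite mulr0.
    by rewrite mulrDr -[0]addr0; exact: GD.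
  by rewrite mulrCA -[0](scaler0 _ c); exact: GM.
have r0 : G (s ^+ M * r) 0 by apply: (gen _ idM) => //; exists M, v.
by have := linear_graphB linG rv r0; rewrite subrr subr0.
Qed.

(** By the vanishing above, G extends by 0 to a power of s. *)
Lemma torsion_extend G s : linear_graph G -> functional G ->
  (forall v : V, exists k, s ^+ k *: v = 0) ->
  exists G', [/\ linear_graph G', functional G', forall u v, G u v -> G' u v
    & exists M, G' (s ^+ M : R^o) 0].
Proof.
move=> linG funG tors; have [G0 GD GZ] := linG.
have [M vanish] := torsion_vanish linG funG tors.
exists (fun a v => exists r, G (a - s ^+ M * r) v); split.
- split=> [|u u' v v' [r ur] [r' ur']|c u v [r ur]].
  + by exists 0; rewrite mulr0 subr0.
  + exists (r + r'); rewrite mulrDr opprD addrACA; exact: GD.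
  + exists (c * r); rewrite mulrCA; have := GZ c _ _ ur; congr G.
    exact: (mulrBr c u).
- move=> v [r]; rewrite sub0r -mulrN; exact: vanish.
- by move=> u v uv; exists 0; rewrite mulr0 subr0.
- by exists M, 1; rewrite mulr1 subrr.
Qed.

Lemma torsion_extend_seq G (ss : seq R) : linear_graph G -> functional G ->
  (forall s, s \in ss -> forall v : V, exists k, s ^+ k *: v = 0) ->
  exists G', [/\ linear_graph G', functional G', forall u v, G u v -> G' u v
    & exists M, forall s, s \in ss -> G' (s ^+ M : R^o) 0].
Proof.
elim: ss G => [|s ss IH] G linG funG tors; first by exists G; split=> //; exists 0%N.
have [|G1 [linG1 funG1 GG1 [M1 HM1]]] := IH G linG funG.
  by move=> s' s's; apply: tors; rewrite inE s's orbT.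
have [G2 [linG2 funG2 GG2 [M2 HM2]]] := torsion_extend linG1 funG1 (tors s (mem_head _ _)).
have [_ _ GZ] := linG2.
have GM r a v : G2 a v -> G2 (r * a) (r *: v) by exact: GZ.
exists G2; split=> // [u v /GG1/GG2 //|].
exists (M1 + M2)%N => s'; rewrite inE exprD -[0](scaler0 _ (s' ^+ M1)).
case/orP=> [/eqP ->|/HM1/GG2]; first exact: GM.
by rewrite !scaler0 mulrC -{2}[0](scaler0 _ (s' ^+ M2)); exact: GM.
Qed.

End Torsion.

(** Linear functionals extend from a subspace to the whole space; here V is the
    graph of the functional and only the coordinates in bs matter. By induction
    on bs: the value of e at b0 is forced if the subspace has an element whose
    only nonzero coordinate is at b0, and arbitrary otherwise. *)
Lemma functional_coordinates (K : fieldType) (B : eqType) (bs : seq B)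
    (V : (B -> K) -> K -> Prop) :
  uniq bs ->
  (forall c u u' k k', V u k -> V u' k' -> V (fun b => c * u b + u' b) (c * k + k')) ->
  (forall u k, V u k -> (forall b, b \in bs -> u b = 0) -> k = 0) ->
  exists e : B -> K, forall u k, V u k -> k = \sum_(b <- bs) u b * e b.
Proof.
elim: bs V => [|b0 bs IH] V /= => [_|/andP[b0bs ubs]] VD V0.
  by exists (fun=> 0) => u k uk; rewrite big_nil; exact: (V0 _ _ uk).
have [e0 He0] : exists e0, forall u k, V u k -> (forall b, b \in bs -> u b = 0) ->
    k = u b0 * e0.
  have [[u0 [k0 [uk0 u00 nz]]]|no] := pselect (exists u0 k0,
      [/\ V u0 k0, forall b, b \in bs -> u0 b = 0 & u0 b0 != 0]); last first.
    exists 0 => u k uk u0; rewrite mulr0; apply: (V0 _ _ uk) => b.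
    rewrite inE => /orP[/eqP ->|/u0 //]; apply/eqP; apply: contra_notT no => ub.
    by exists u, k.
  exists (k0 / u0 b0) => u k uk uz.
  have H := V0 _ _ (VD (- (u b0 / u0 b0)) _ _ _ _ uk0 uk).
  apply/eqP; rewrite -subr_eq0; apply/eqP; rewrite -[RHS]H => [|b].
    by rewrite mulNr addrC mulrAC mulrA.
  rewrite inE => /orP[/eqP ->|bbs]; last by rewrite (u00 _ bbs) (uz _ bbs) mulr0 addr0.
  by rewrite mulNr divfK // addNr.
have [//||u k uk u0|e He] := IH (fun u k => V u (k + u b0 * e0)).
- move=> c u u' k k' uk uk'; have := VD c _ _ _ _ uk uk'; congr V.
  by rewrite mulrDr addrACA mulrDl mulrA.
- by apply: (addIr (u b0 * e0)); rewrite add0r; exact: (He0 _ _ uk).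
exists (fun b => if b == b0 then e0 else e b) => u k uk.
rewrite big_cons eqxx -[LHS](subrK (u b0 * e0)) addrC; congr (_ + _).
rewrite (He u (k - u b0 * e0)) ?subrK //; apply: eq_big_seq => b bbs.
by case: eqP => // bb0; rewrite -bb0 bbs in b0bs.
Qed.

(** * Extending homomorphisms into Laurent polynomials tensor inverse systems *)

Section Baer.
Variables (K : fieldType) (I W : finType) (grade : zmodType).
Variables (dt : I -> grade) (ds : W -> grade).
Implicit Types (n : {ffun I -> nat}) (b : {ffun W -> nat}) (a : {ffun I -> int}).
Local Notation expo := ({ffun I -> int} * {ffun W -> nat})%type.

Definition ldeg a : grade := \sum_i dt i *~ a i.
Definition ideg b : grade := \sum_w ds w *+ b w.
Definition lnat n : {ffun I -> int} := [ffun i => (n i)%:Z].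

Hypothesis ldeg_inj : injective ldeg.

Lemma ldegD a a' : ldeg (a + a') = ldeg a + ldeg a'.
Proof. by rewrite /ldeg -big_split; apply: eq_bigr => i _; rewrite ffunE mulrzDr. Qed.

Lemma ldegB a a' : ldeg (a - a') = ldeg a - ldeg a'.
Proof. by apply: (addIr (ldeg a')); rewrite -ldegD !subrK. Qed.

Lemma lnat_shift a : exists n n', a + lnat n' = lnat n.
Proof.
exists [ffun i => if a i is Posz k then k else 0%N],
  [ffun i => if a i is Negz k then k.+1 else 0%N].
apply/ffunP => i; rewrite !ffunE; case: (a i) => k; first by rewrite addr0.
by rewrite NegzE addNr.
Qed.

(** S stands for the polynomial ring K[t_i, s_w] and E for the tensor product of
    the Laurent polynomials in the t_i and the inverse system of the s_w, with
    basis bas. The argument only uses the rules by which monomials multiply and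
    act. *)
Variables (S : comAlgType K) (homS : grade -> S -> Prop).
Variables (tm : {ffun I -> nat} -> S) (sv : W -> S) (sm : {ffun W -> nat} -> S).
Hypothesis noeS : noetherian S.
Hypothesis homSD : forall dl p q, homS dl p -> homS dl q -> homS dl (p + q).
Hypothesis homSZ : forall dl (c : K) p, homS dl p -> homS dl (c *: p).
Hypothesis homS1 : homS 0 1.
Hypothesis homSM : forall dl dl' p q, homS dl p -> homS dl' q -> homS (dl + dl') (p * q).
Hypothesis homS_tm : forall n, homS (ldeg (lnat n)) (tm n).
Hypothesis homS_sm : forall b, homS (ideg b) (sm b).
Hypothesis tm0 : tm [ffun=> 0%N] = 1.
Hypothesis smM : forall b b', sm b * sm b' = sm [ffun w => b w + b' w]%N.
Hypothesis smX : forall w k, sm [ffun v => ((v == w) * k)%N] = sv w ^+ k.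
Hypothesis homS_spanned : forall dl p, homS dl p -> forall V : S -> Prop, submodule V ->
  (forall n b, ldeg (lnat n) + ideg b = dl -> V (tm n * sm b)) -> V p.

Implicit Types (p q : S).
Variables (E : lmodType S) (bas : expo -> E) (esupp : E -> seq expo).
Variables (coef : E -> expo -> K) (res : E -> K).

Definition expo_deg (c : expo) : grade := ldeg c.1 - ideg c.2.
Definition homogE (nu : grade) (e : E) : Prop := forall c, c \in esupp e -> expo_deg c = nu.

Hypothesis basE : forall e, e = \sum_(c <- esupp e) (coef e c)%:A *: bas c.
Hypothesis coefE : forall e c,
  coef e c = \sum_(c' <- esupp e) coef e c' * (c' == c)%:R.
Hypothesis tm_act : forall n a b, tm n *: bas (a, b) = bas (a + lnat n, b).
Hypothesis sv_act : forall w k a b, sv w ^+ k *: bas (a, b) =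
  if (k <= b w)%N then bas (a, [ffun v => b v - (v == w) * k]%N) else 0.
Hypothesis sm_act : forall b a b', sm b *: bas (a, b') =
  if [forall w, b w <= b' w]%N then bas (a, [ffun w => b' w - b w]%N) else 0.
Hypothesis homogE0 : forall nu, homogE nu 0.
Hypothesis homogED : forall nu u v, homogE nu u -> homogE nu v -> homogE nu (u + v).
Hypothesis homogE_scale : forall dl nu p u, homS dl p -> homogE nu u -> homogE (dl + nu) (p *: u).
Hypothesis homogE_bas : forall c, homogE (expo_deg c) (bas c).
Hypothesis homogE_inj : forall nu u v, homogE nu u -> homogE nu v ->
  (forall c, expo_deg c = nu -> coef u c = coef v c) -> u = v.

(** The residue is the coefficient of the empty monomial of the inverse system
    once all t_i are set to 1. It replaces the evaluation at 1 by which the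
    elements of the dual of a polynomial ring are recovered. *)
Hypothesis resD : forall u v, res (u + v) = res u + res v.
Hypothesis res_const : forall (c : K) u, res (c%:A *: u) = c * res u.
Hypothesis res_bas : forall c, res (bas c) = (c.2 == [ffun=> 0%N])%:R.

Lemma homogE_const nu (c : K) u : homogE nu u -> homogE nu (c%:A *: u).
Proof. by move=> hu; rewrite -[nu]add0r; apply: homogE_scale => //; exact: homSZ. Qed.

Lemma homogE_sum nu (r : seq {ffun W -> nat}) (F : {ffun W -> nat} -> E) :
  (forall b, b \in r -> homogE nu (F b)) -> homogE nu (\sum_(b <- r) F b).
Proof. by move=> h; rewrite big_seq; elim/big_ind: _ => //; exact: homogED. Qed.

Lemma res0 : res 0 = 0.
Proof. by apply: (addIr (res 0)); rewrite -resD !add0r. Qed.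

Lemma res_sum (J : Type) (r : seq J) (F : J -> E) :
  res (\sum_(i <- r) F i) = \sum_(i <- r) res (F i).
Proof. exact: (big_morph res resD res0). Qed.

Lemma res_tmon n (e : E) : res (tm n *: e) = res e.
Proof.
rewrite [e]basE scaler_sumr; rewrite !res_sum; apply: eq_bigr => c _.
by case: c => a b; rewrite scale_swap tm_act !res_const !res_bas.
Qed.

Lemma res_shift (p : S) a a' b :
  res (p *: bas (a, b)) = res (p *: bas (a', b)).
Proof.
have shift n c : res (p *: bas (c + lnat n, b)) = res (p *: bas (c, b)).
  by rewrite -[in RHS](res_tmon n) scalerA mulrC -scalerA tm_act.
have [n [n' an]] := lnat_shift (a - a').
by rewrite -(shift n' a) -[a](subrK a') addrAC an addrC shift.
Qed.

Lemma res_ts n b a b' :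
  res ((tm n * sm b) *: bas (a, b')) =
    ([forall w, b w <= b' w]%N && [forall w, b' w <= b w]%N)%:R.
Proof.
rewrite -scalerA res_tmon sm_act.
case: [forall w, _] => /=; last exact: res0.
rewrite res_bas /=; congr (nat_of_bool _)%:R.
apply/eqP/forallP => [/ffunP h w|h]; first by have := h w; rewrite !ffunE => /eqP.
by apply/ffunP => w; rewrite !ffunE; apply/eqP; exact: h.
Qed.

Lemma iexp_leq_anti b b' : [forall w, b w <= b' w]%N && [forall w, b' w <= b w]%N = (b == b').
Proof.
apply/andP/eqP => [[/forallP h /forallP h']|->]; last by split; apply/forallP.
by apply/ffunP => w; apply/eqP; rewrite eqn_leq h h'.
Qed.

(** Up to degree, a basis element (a, b) is the only one that s^b moves to the
    empty monomial of the inverse system. *)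
Lemma res_smon (e : E) a b : homogE (expo_deg (a, b)) e ->
  res (sm b *: e) = coef e (a, b).
Proof.
move=> he; rewrite {1}[e]basE scaler_sumr res_sum [RHS]coefE.
apply: eq_big_seq => -[a' b'] /he hc.
rewrite scale_swap res_const; congr (_ * _).
rewrite -[sm b]mul1r -tm0 res_ts iexp_leq_anti xpair_eqE.
rewrite [b == b']eq_sym; case: eqP => [bb|_]; last by rewrite andbF.
rewrite andbT; rewrite bb in hc.
have -> : a' = a by apply: ldeg_inj; exact: (addIr _ hc).
by rewrite eqxx.
Qed.

Lemma sv_nilpotent (w : W) (e : E) : exists k, sv w ^+ k *: e = 0.
Proof.
exists (\sum_(c <- esupp e) (c.2 w).+1)%N.
rewrite {2}[e]basE scaler_sumr big1_seq // => -[a b] /andP[_ ce].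
rewrite scale_swap sv_act (big_rem _ ce) /= addSn ltnNge leq_addr.
exact: scaler0.
Qed.

(** After extending the graph G by 0 on powers of the s_w, the residues of its
    values are functions of the residues of p *: bas (0, b) for finitely many b,
    and e is found by extending a functional on a finite-dimensional space.
    Restricting b to those that occur in degree mu makes e homogeneous. *)
Theorem baer_extension (G : (S^o) -> E -> Prop) (mu : grade) :
  linear_graph G -> functional G ->
  exists2 e : E, homogE mu e & forall (dl : grade) (p : S) (v : E),
    homS dl p -> homogE (dl + mu) v -> G p v -> v = p *: e.
Proof.
move=> linG funG.
have [] := torsion_extend_seq noeS 
  (ss := [seq sv w | w <- enum (W)]) linG funG.
  by move=> _ /mapP[w _ ->] v; exact: sv_nilpotent.
move=> {linG funG}H [linH funH GH [N HN]].
have [H0 HD HZ] := linH.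
have HM r (p : S) v : H p v -> H (r * p) (r *: v) by exact: HZ.
have HB (p q : S) u v : H p u -> H q v -> H (p - q) (u - v) by move=> hp hq; exact: (linear_graphB linH hp hq).
have HDD (p q : S) u v : H p u -> H q v -> H (p + q) (u + v) by exact: HD.
have {}HN (w : W) : H (sv w ^+ N : S) 0.
  by apply: (HN (sv w)); apply/mapP; exists w; rewrite ?mem_enum.
(* an element of degree mu killed by all sv w ^+ N involves only the exponents
   b below N such that some (a, b) has degree mu *)
pose occ b := `[< exists a, expo_deg (a, b) = mu >].
pose bs : seq ({ffun W -> nat}) := [seq b <- [seq [ffun w => f w : nat] |
  f : {ffun W -> 'I_N}] | occ b].
have bs_uniq : uniq bs.
  apply: filter_uniq; rewrite map_inj_uniq ?enum_uniq // => f f' /ffunP ff.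
  by apply/ffunP => w; apply: val_inj; have := ff w; rewrite !ffunE.
have mem_bs b : (forall w, (b w < N)%N) -> occ b -> b \in bs.
  move=> bN bocc; rewrite mem_filter bocc /=; apply/mapP.
  exists [ffun w => Ordinal (bN w)]; first by rewrite mem_enum.
  by apply/ffunP => w; rewrite !ffunE.
have /choice[la Hla] : forall b, exists a, occ b -> expo_deg (a, b) = mu.
  by move=> b; have [/asboolP[a ab]|/negP nb] := boolP (occ b); [exists a|exists 0].
have [rho rhoE] : exists rho : S -> {ffun W -> nat} -> K,
  forall p b, rho p b = res (p *: bas (0, b)) by eexists.
have rhoD p q b : rho (p + q) b = rho p b + rho q b.
  by rewrite !rhoE scalerDl resD.
have rhoZ c p b : rho (c *: p) b = c * rho p b.
  by rewrite !rhoE scale_algA res_const.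
have rho_tmon n p b : rho (tm n * p) b = rho p b.
  by rewrite !rhoE -scalerA res_tmon.
(* for v of degree outside the span of the dt i, the residue is 0 and carries no
   information; such v are reached later by multiplying by a monomial sm b *)
pose Hx (p : S) v := H p v /\
  exists a, homS (ldeg a - mu) p /\ homogE (ldeg a) v.
pose V (u : {ffun W -> nat} -> K) k := exists p v, [/\ Hx p v, forall b, u b = rho p b & k = res v].
have VD c u u' k k' : V u k -> V u' k' -> V (fun b => c * u b + u' b) (c * k + k').
  move=> [p [v [[pv [a [pa va]]] up ->]]] [p' [v' [[pv' [a' [pa' va']]] up' ->]]].
  have [n [n' an]] := lnat_shift (a - a').
  have aE : lnat n + a' = lnat n' + a by rewrite -an addrC addrA subrKC addrC.
  have key b : rho (c *: (tm n' * p) + tm n * p') b = c * rho p b + rho p' b.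
    by rewrite rhoD rhoZ 2!rho_tmon.
  exists (c *: (tm n' * p) + tm n * p').
  exists (c%:A *: (tm n' *: v) + tm n *: v'); split.
  - split.
      apply: HDD; last exact: HM.
      by rewrite -[c *: _]mulr_algl; do 2!apply: (HM).
    exists (lnat n' + a); split.
      apply: homSD.
        by apply: homSZ; rewrite ldegD -addrA; exact: homSM.
      by rewrite -aE ldegD -addrA; exact: homSM.
    apply: homogED.
      apply: homogE_const; rewrite ldegD; exact: homogE_scale.
    by rewrite -aE ldegD; exact: homogE_scale.
  - by move=> b; rewrite up up' -key.
  - by rewrite resD res_const !res_tmon.
have V0 u k : V u k -> (forall b, b \in bs -> u b = 0) -> k = 0.
  move=> [p [v [[pv [a [pa va]]] up ->]]] u0.
  pose dl := ldeg a - mu.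
  have /choice[nb Hnb] : forall b, exists n', forall n, ldeg (lnat n) + ideg b = dl -> n' = n.
    move=> b; have [[n nd]|no] := pselect (exists n, ldeg (lnat n) + ideg b = dl); last first.
      by exists [ffun=> 0%N] => n nd; case: no; exists n.
    exists n => n' nd'; apply/ffunP => i.
    have := nd; rewrite -nd' => /addIr/ldeg_inj/ffunP/(_ i).
    by rewrite !ffunE => -[].
  pose tr (q : S) : S := \sum_(b <- bs) rho q b *: (tm (nb b) * sm b).
  suff : H (p - tr p) 0.
    rewrite [tr p]big1_seq => [|b /andP[_ bbs]]; last first.
      by rewrite -up u0 // scale0r.
    rewrite subr0 => /(HB _ _ _ _ pv); rewrite subrr subr0 => /funH ->.
    exact: res0.
  apply: (homS_spanned pa (V := fun q => H (q - tr q) 0)).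
    have trD q q' : tr (q + q') = tr q + tr q'.
      by rewrite -big_split; apply: eq_bigr => b _; rewrite rhoD scalerDl.
    have trZ c q : tr (c *: q) = c *: tr q.
      by rewrite scaler_sumr; apply: eq_bigr => b _; rewrite rhoZ scalerA.
    split=> [|q q' Hq Hq'|c q Hq].
    - have -> : tr 0 = 0 by rewrite -[in LHS](scale0r (0 : S)) trZ scale0r.
      by rewrite subr0.
    - by rewrite trD opprD addrACA -[0]addr0; exact: HDD.
    - by rewrite trZ -scalerBr -mulr_algl -[0](scaler0 _ c%:A); exact: HM.
  move=> n b nd.
  have rho_ts b' : rho (tm n * sm b) b' = (b == b')%:R.
    by rewrite rhoE res_ts iexp_leq_anti.
  have [bN|/existsP[w]] := boolP [forall w, b w < N]%N; last first.
    rewrite -leqNgt => Nb.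
    suff Hs : H (tm n * sm b) 0.
      suff -> : tr (tm n * sm b) = 0 by rewrite subr0.
      rewrite [tr _]big1_seq // => b' /andP[_]; rewrite rho_ts.
      case: eqP => [<-|_]; last by rewrite scale0r.
      rewrite mem_filter => /andP[_ /mapP[f _ bf]].
      by move: Nb; rewrite bf ffunE leqNgt ltn_ord.
    have -> : sm b = sm [ffun v => b v - (v == w) * N]%N * sv w ^+ N.
      rewrite -smX smM; congr sm; apply/ffunP => w'; rewrite !ffunE subnK //.
      by case: eqP => [->|_]; rewrite ?mul1n.
    by rewrite mulrA -[0](scaler0 _ (tm n * sm [ffun v => b v - (v == w) * N]%N)); exact: HM.
  have bbs : b \in bs.
    apply: mem_bs; first exact/forallP.
    apply/asboolP; exists (a - lnat n); rewrite /expo_deg ldegB.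
    by rewrite -addrA -opprD nd /dl subKr.
  suff -> : tr (tm n * sm b) = tm n * sm b by rewrite subrr.
  rewrite [tr _](bigD1_seq b) //= rho_ts eqxx scale1r (Hnb _ n nd) big1 ?addr0 // => b' bb'.
  by rewrite rho_ts eq_sym (negbTE bb') scale0r.
have [ec Hec] := functional_coordinates bs_uniq VD V0.
pose e : E := \sum_(b <- bs) (ec b)%:A *: bas (la b, b).
have he : homogE mu e.
  apply: homogE_sum => b; rewrite mem_filter => /andP[/Hla <- _].
  by apply: homogE_const; exact: homogE_bas.
have res_eq a (p : S) v : H p v -> homS (ldeg a - mu) p -> homogE (ldeg a) v ->
    res v = res (p *: e).
  move=> pv pa va; rewrite (Hec (rho p) (res v)); last first.
    by exists p, v; split=> //; split=> //; exists a.
  rewrite scaler_sumr res_sum; apply: eq_bigr => b _.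
  by rewrite scale_swap res_const mulrC (res_shift p (la b) 0) rhoE.
exists e => // dl p v pdl vdl /GH pv.
apply: (homogE_inj vdl); first exact: homogE_scale.
move=> [a b] ab; rewrite -(@res_smon v) ?ab // -(@res_smon (p *: e)) ?ab; last first.
  exact: homogE_scale.
have bE : ideg b + (dl + mu) = ldeg a by rewrite -ab /expo_deg /= addrC subrK.
rewrite scalerA; apply: (res_eq a); first exact: HM.
  by rewrite -bE addrA addrK; exact: homSM.
by rewrite -bE; exact: homogE_scale.
Qed.

End Baer.

(** ** The case of E_x *)

Section Envelope.
Variables (K : fieldType) (d : Order.disp_t) (P : finBPOrderType d) (x : P).
Local Notation S := (polyS K P).
Local Notation tensor := {malg K[(lexp x * iexp x)%type]}.
Local Notation grade := 'rV[int]_(nvert P).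

Definition vdeg (i : vx x) : grade := delta_mx 0 (val i).
Definition wdeg (w : pminus x) : grade := deg (val (val w)).

Lemma vdeg_inj : injective (ldeg vdeg).
Proof.
move=> a a' e; apply/ffunP => i.
have coord c : ldeg vdeg c 0 (val i) = c i.
  rewrite summxE (bigD1 i) //= big1 => [|j ji].
    by rewrite -scaler_int !mxE !eqxx addr0 mulr1 intz.
  by rewrite -scaler_int !mxE (inj_eq val_inj) eq_sym (negbTE ji) andbF mulr0.
by rewrite -!coord e.
Qed.

Lemma ldeg_lnat n : ldeg vdeg (lnat n) = \sum_(i : vx x) delta_mx 0 (val i) *+ n i.
Proof. by apply: eq_bigr => i _; rewrite ffunE pmulrn. Qed.

Definition residue_basis (c : lexp x * iexp x) : K^o := (c.2 == [ffun=> 0%N])%:R.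

Theorem Ex_baer (G : S^o -> Ex K x -> Prop) (mu : grade) :
  linear_graph G -> functional G ->
  exists2 e : Ex K x, homog (Ex K x) mu e & forall dl (p : S) (v : Ex K x),
    homogS dl p -> homog (Ex K x) (dl + mu) v -> G p v -> v = p *: e.
Proof.
move=> linG funG.
have [g0 gB gS _ _] := env_is_grading K x.
apply: (@baer_extension K (vx x) (pminus x) grade vdeg wdeg vdeg_inj S (@homogS K d P)
  (tmon K (x := x)) (svar K (x := x)) (smon K (x := x)) _ _ _ _ _ _ _ _ _ _ _
  (env K x) (bas K (x := x)) (fun e => msupp (e : tensor))
  (fun e c => (e : tensor)@_c) (linext residue_basis) _ _ _ _ _ _ _ _ _ _ _ _ _ G mu linG funG).
- exact: malg_noetherian.
- exact: homogSD.
- exact: homogSZ.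
- exact: homogS1.
- exact: homogSM.
- by move=> n; rewrite ldeg_lnat; exact: homogS_tmon.
- exact: homogS_smon.
- exact: tmon0.
- exact: smonD.
- exact: smonX.
- move=> dl p /homogS_spanned pdl V Vsub Vts; apply: pdl => // n b nb.
  by apply: Vts; rewrite ldeg_lnat.
- exact: env_basE.
- move=> e c; rewrite {1}[e]malg_basis raddf_sum /=; apply: eq_bigr => c' _.
  by rewrite mcoeffZ mcoeffU.
- by move=> n a b; rewrite tmon_bas.
- exact: svarX_bas.
- exact: smon_bas.
- exact: env_homog0.
- exact: env_homogD.
- exact: gS.
- exact: env_homogU.
- move=> nu u v /env_homogP hu /env_homogP hv uv; apply/malgP => c.
  by have [/uv//|nc] := eqVneq (envdeg c) nu; rewrite hu // hv.
- exact: (linearD (linext residue_basis)).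
- by move=> c u; rewrite env_constE; exact: (linearZ_LR (linext residue_basis)).
- exact: (linextU residue_basis).
Qed.

End Envelope.

(** * Homogeneous components *)

Section Components.
Variables (K : fieldType) (d : Order.disp_t) (P : finBPOrderType d).
Local Notation S := (polyS K P).
Local Notation grade := 'rV[int]_(nvert P).
Implicit Types (M N : grmod K P).

Lemma homog0 M a : homog M a 0.
Proof. by case: (grmodP M). Qed.

Lemma homogB M a u v : homog M a u -> homog M a v -> homog M a (u - v).
Proof. by case: (grmodP M) => _ + _ _ _; apply. Qed.

Lemma homogD M a u v : homog M a u -> homog M a v -> homog M a (u + v).
Proof.
move=> ua va; rewrite -[v]opprK -[- v]add0r; apply: homogB => //.
by apply: homogB => //; exact: homog0.
Qed.

Lemma homog_scale M a b (p : S) (u : M) :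
  homogS a p -> homog M b u -> homog M (a + b) (p *: u).
Proof. by case: (grmodP M) => _ _ + _ _; apply. Qed.

Lemma homog_sum M a (I : Type) (r : seq I) (Q : pred I) (F : I -> M) :
  (forall i, Q i -> homog M a (F i)) -> homog M a (\sum_(i <- r | Q i) F i).
Proof.
by move=> h; elim/big_ind: _ => //; [exact: homog0|exact: homogD].
Qed.

Lemma homog_sum_eq0 M (s : seq grade) (c : grade -> M) :
  (forall a, homog M a (c a)) -> (forall a, a \notin s -> c a = 0) ->
  \sum_(a <- undup s) c a = 0 -> forall a, c a = 0.
Proof.
move=> hc cs s0 a; have [as_|/cs //] := boolP (a \in s).
case: (grmodP M) => _ _ _ _ uniq_dec.
by apply: (uniq_dec (undup s) c) => //; rewrite ?undup_uniq ?mem_undup.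
Qed.

Lemma homog_decomp M (u : M) : exists (c : grade -> M) (s : seq grade),
  [/\ forall a, homog M a (c a), forall a, a \notin s -> c a = 0
    & u = \sum_(a <- undup s) c a].
Proof.
case: (grmodP M) => _ _ _ /(_ u)[s [c [hc ->]]] _.
exists (fun a => \sum_(b <- s | b == a) c b), s; split.
- by move=> a; apply: homog_sum => b /eqP <-.
- move=> a as_; rewrite big1_seq // => b /andP[/eqP -> ba].
  by rewrite ba in as_.
rewrite (exchange_big_dep predT) //=; apply: eq_big_seq => b bs.
rewrite -big_filter (@eq_filter _ _ (pred1 b)) => [|a]; last exact: eq_sym.
by rewrite filter_pred1_uniq ?undup_uniq ?mem_undup // big_seq1.
Qed.

(** A grading provides for each element some finite family of homogeneous
    summands; uniqueness of these families makes them depend on the element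
    only, and additively. *)
Lemma component_exists M : exists comp : grade -> M -> M,
  [/\ forall a u, homog M a (comp a u),
      forall a u v, comp a (u + v) = comp a u + comp a v,
      forall a b u, homog M b u -> comp a u = if a == b then u else 0
    & forall u, exists s : seq grade, u = \sum_(a <- s) comp a u].
Proof.
have /choice[f Hf] : forall u : M, exists cs : (grade -> M) * seq grade,
  [/\ forall a, homog M a (cs.1 a), forall a, a \notin cs.2 -> cs.1 a = 0
    & u = \sum_(a <- undup cs.2) cs.1 a].
  by move=> u; have [c [s h]] := homog_decomp u; exists (c, s).
have widen u s : u = \sum_(a <- undup ((f u).2 ++ s)) (f u).1 a.
  have [_ f0 {1}->] := Hf u; apply/esym.
  rewrite (bigID (fun a => a \in (f u).2)) /= [X in _ + X]big1 ?addr0 => [|a /f0 //].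
  rewrite -big_filter; apply: perm_big; apply: uniq_perm.
  - by rewrite filter_uniq ?undup_uniq.
  - by rewrite undup_uniq.
  by move=> a; rewrite mem_filter !mem_undup mem_cat; case: (a \in (f u).2).
have uniq_comp u (c : grade -> M) s : (forall a, homog M a (c a)) ->
    (forall a, a \notin s -> c a = 0) -> u = \sum_(a <- undup s) c a ->
    forall a, (f u).1 a = c a.
  move=> hc cs us a; have [hf f0 _] := Hf u; apply/eqP; rewrite -subr_eq0; apply/eqP.
  apply: (@homog_sum_eq0 M ((f u).2 ++ s) (fun a => (f u).1 a - c a)).
  - by move=> b; exact: homogB.
  - by move=> b; rewrite mem_cat negb_or => /andP[/f0 -> /cs ->]; rewrite subrr.
  rewrite sumrB -widen {1}us; apply/eqP; rewrite subr_eq0; apply/eqP/esym.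
  rewrite (bigID (fun a => a \in s)) /= [X in _ + X]big1 ?addr0 => [|b /cs //].
  rewrite -big_filter; apply: perm_big; apply: uniq_perm.
  - by rewrite filter_uniq ?undup_uniq.
  - by rewrite undup_uniq.
  by move=> b; rewrite mem_filter !mem_undup mem_cat orbC; case: (b \in s).
exists (fun a u => (f u).1 a); split.
- by move=> a u; have [] := Hf u.
- move=> a u v; have [hu u0 _] := Hf u; have [hv v0 _] := Hf v.
  apply: (@uniq_comp (u + v) (fun a => (f u).1 a + (f v).1 a) ((f u).2 ++ (f v).2)).
  + by move=> b; exact: homogD.
  + by move=> b; rewrite mem_cat negb_or => /andP[/u0 -> /v0 ->]; rewrite addr0.
  rewrite big_split /= -widen; congr (_ + _); rewrite {1}[v](widen v (f u).2).
  by apply: perm_big; apply: uniq_perm; rewrite ?undup_uniq // => b;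
    rewrite !mem_undup !mem_cat orbC.
- move=> a b u hu.
  apply: (@uniq_comp u (fun a => if a == b then u else 0) [:: b]).
  + by move=> c; case: eqP => [->|_] //; exact: homog0.
  + by move=> c; rewrite inE => /negbTE ->.
  by rewrite big_seq1 eqxx.
- by move=> u; exists (undup (f u).2); have [] := Hf u.
Qed.

Definition component M : grade -> M -> M := sval (cid (component_exists M)).

Lemma component_homog M a (u : M) : homog M a (component a u).
Proof. by rewrite /component; case: cid => c []. Qed.

Lemma componentD M a (u v : M) : component a (u + v) = component a u + component a v.
Proof. by rewrite /component; case: cid => c [] /=. Qed.

Lemma component_of_homog M a b (u : M) :
  homog M b u -> component a u = if a == b then u else 0.
Proof. by rewrite /component; case: cid => c [_ _ h _] /=; exact: h. Qed.

Lemma componentE M (u : M) : exists s, u = \sum_(a <- s) component a u.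
Proof. by rewrite /component; case: cid => c [_ _ _ h] /=; exact: h. Qed.

Lemma component0 M a : component a (0 : M) = 0.
Proof. by rewrite (component_of_homog _ (homog0 M a)) eqxx. Qed.

Lemma componentB M a (u v : M) : component a (u - v) = component a u - component a v.
Proof. by apply: (addIr (component a v)); rewrite -componentD !subrK. Qed.

Lemma component_sum M a (I : Type) (r : seq I) (Q : pred I) (F : I -> M) :
  component a (\sum_(i <- r | Q i) F i) = \sum_(i <- r | Q i) component a (F i).
Proof. exact: (big_morph _ (componentD a) (component0 M a)). Qed.

Lemma component_eq0 M (u : M) : (forall a, component a u = 0) -> u = 0.
Proof. by move=> u0; have [s ->] := componentE u; rewrite big1. Qed.

Lemma component_morph M N (f : {linear M -> N}) a u : degree_preserving f ->
  component a (f u) = f (component a u).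
Proof.
move=> hf; have [s us] := componentE u.
rewrite {1}us linear_sum component_sum {2}us component_sum linear_sum.
apply: eq_bigr => b _; rewrite (component_of_homog a (hf _ _ (component_homog b u))).
rewrite (component_of_homog a (component_homog b u)).
by case: eqP; rewrite ?linear0.
Qed.

Definition Scomponent (a : grade) (p : S) : S :=
  \sum_(m <- msupp p | mondeg m == a) p@_m *: << m >>.

Lemma Scomponent_homog a p : homogS a (Scomponent a p).
Proof.
rewrite /Scomponent; elim/big_ind: _ => [|q r|m /eqP <-]; first exact: homogS0.
  exact: homogSD.
by apply: homogSZ; exact: homogSU.
Qed.

Lemma component_scale M a b (p : S) (u : M) : homog M b u ->
  component a (p *: u) = Scomponent (a - b) p *: u.
Proof.
move=> hu; rewrite {1}[p]malg_basis scaler_suml component_sum /Scomponent scaler_suml.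
rewrite [RHS]big_mkcond; apply: eq_bigr => m _.
have hm : homog M (mondeg m + b) ((p@_m *: << m >> : S) *: u).
  by apply: homog_scale => //; apply: homogSZ; exact: homogSU.
by rewrite (component_of_homog a hm) -[a == _]subr_eq eq_sym; case: ifP.
Qed.

End Components.

(** * Injectivity from Baer's criterion *)

Section Injective.
Variables (K : fieldType) (d : Order.disp_t) (P : finBPOrderType d).
Local Notation S := (polyS K P).
Local Notation grade := 'rV[int]_(nvert P).

Variable E : grmod K P.
Hypothesis baer : forall (G : S^o -> E -> Prop) (mu : grade),
  linear_graph G -> functional G ->
  exists2 e : E, homog E mu e & forall dl (p : S) (v : E),
    homogS dl p -> homog E (dl + mu) v -> G p v -> v = p *: e.

(** A maximal graded extension of g is defined everywhere: if it is not defined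
    at the homogeneous element u of degree mu, then the homomorphism p |-> G (p u)
    from an ideal to E is multiplication by some e of degree mu, and u |-> e
    extends G. *)
Theorem baer_star_injective : star_injective E.
Proof.
move=> N M i g hi i_inj hg.
pose good (G : M -> E -> Prop) := [/\ linear_graph G, functional G,
  forall u v a, G u v -> G (component a u) (component a v) & forall w, G (i w) (g w)].
have good0 : good (fun u v => exists2 w, u = i w & v = g w).
  split=> [|v [w]|u v a [w -> ->]|w].
  - split=> [|u u' v v' [w -> ->] [w' -> ->]|r u v [w -> ->]].
    + by exists 0; rewrite linear0.
    + by exists (w + w'); rewrite linearD.
    + by exists (r *: w); rewrite linearZ.
  - by rewrite -(linear0 i) => /i_inj <- ->; rewrite linear0.
  - by exists (component a w); rewrite component_morph.
  - by exists w.
pose T := {G : M -> E -> Prop | good G}.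
pose R (G H : T) := `[< forall u v, sval G u v -> sval H u v >].
have [||C totC|[G goodG] maxG] := @classical_sets.ZL_preorder T (exist _ _ good0) R.
- by move=> G; apply/asboolP.
- by move=> G H J /asboolP GH /asboolP HJ; apply/asboolP => u v /GH/HJ.
- have [[G0 CG0]|C0] := pselect (exists G, C G); last first.
    by exists (exist _ _ good0) => G CG; case: C0; exists G.
  pose U u v := exists2 G, C G & sval G u v.
  have join G H u v u' v' : C G -> C H -> sval G u v -> sval H u' v' ->
      exists2 J, C J & sval J u v /\ sval J u' v'.
    move=> CG CH uv uv'; have [/asboolP GH|/asboolP HG] := totC _ _ CG CH.
      by exists H => //; split=> //; exact: GH.
    by exists G => //; split=> //; exact: HG.
  have goodU : good U.
    split=> [|v [G CG]|u v a [G CG uv]|w].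
    - split=> [|u u' v v' [G CG uv] [H CH uv']|r u v [G CG uv]].
      + by exists G0 => //; case: (svalP G0) => -[].
      + have [J CJ [Juv Juv']] := join _ _ _ _ _ _ CG CH uv uv'.
        by exists J => //; case: (svalP J) => -[_ JD _] _ _ _; exact: JD.
      + by exists G => //; case: (svalP G) => -[_ _ GZ] _ _ _; exact: GZ.
    - by case: (svalP G) => _ funG _ _; exact: funG.
    - by exists G => //; case: (svalP G) => _ _ compG _; exact: compG.
    - by exists G0 => //; case: (svalP G0) => _ _ _; exact.
  by exists (exist _ _ goodU) => G CG; apply/asboolP => u v uv; exists G.
have [linG funG compG Gg] := goodG; have [G0 GD GZ] := linG.
have dom_homog mu u : homog M mu u -> exists v, G u v.
  move=> hu; pose Gu (p : S^o) (v : E) := G ((p : S) *: u) v.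
  have [||e he Ge] := @baer Gu mu.
  - split=> [|p p' v v' pv pv'|r p v pv].
    + by rewrite /Gu scale0r.
    + by rewrite /Gu scalerDl; exact: GD.
    + by rewrite /Gu -scalerA; exact: GZ.
  - by move=> v; rewrite /Gu scale0r; exact: funG.
  have Gue (p : S) v : G (p *: u) v -> v = p *: e.
    move=> pv; apply/eqP; rewrite -subr_eq0; apply/eqP; apply: component_eq0 => a.
    rewrite componentB (component_scale a p he).
    have := compG _ _ a pv; rewrite (component_scale a p hu) => pva.
    rewrite (Ge _ _ _ (@Scomponent_homog K d P (a - mu) p) _ pva) ?subrr //.
    by rewrite subrK; exact: component_homog.
  pose G' w v := exists p : S, exists w' v', [/\ G w' v', w = w' + p *: u & v = v' + p *: e].
  have goodG' : good G'.
    split=> [|v [p [w' [v' [wv' e0 ->]]]]|w v a [p [w' [v' [wv' -> ->]]]]|w].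
    - split=> [|w1 w2 v1 v2 [p1 [w1' [v1' [h1 -> ->]]]] [p2 [w2' [v2' [h2 -> ->]]]]
              |r w v [p [w' [v' [h -> ->]]]]].
      + by exists 0, 0, 0; rewrite !scale0r !addr0.
      + exists (p1 + p2), (w1' + w2'), (v1' + v2').
        by rewrite !scalerDl; split; [exact: GD|rewrite addrACA|rewrite addrACA].
      + exists (r * p), (r *: w'), (r *: v').
        by rewrite -!scalerA !scalerDr; split=> //; exact: GZ.
    - have /Gue : G (p *: u) (- v').
        have -> : p *: u = (-1) *: w'.
          by rewrite scaleN1r; apply/eqP; rewrite -addr_eq0 addrC -e0.
        by rewrite -scaleN1r; exact: GZ.
      by move=> <-; rewrite addrN.
    - exists (Scomponent (a - mu) p), (component a w'), (component a v').
      by rewrite !componentD (component_scale a p hu) (component_scale a p he); split=> //; exact: compG.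
    - by exists 0, (i w), (g w); rewrite !scale0r !addr0.
  have sub : R (exist _ _ goodG) (exist _ _ goodG').
    by apply/asboolP => w v wv; exists 0, w, v; rewrite !scale0r !addr0.
  have /asboolP G'G := maxG _ sub; exists e; apply: G'G.
  by exists 1, 0, 0; rewrite !scale1r !add0r.
have /choice[f Gf] : forall u, exists v, G u v.
  move=> u; have [s ->] := componentE u.
  elim/big_ind: _ => [|w w' [v wv] [v' wv']|a _]; first by exists 0.
    by exists (v + v'); exact: GD.
  exact: dom_homog (component_homog a u).
have G_uniq u v : G u v -> v = f u.
  move=> uv; apply/eqP; rewrite -subr_eq0; apply/eqP; apply: funG.
  by rewrite -(subrr u); exact: linear_graphB.
have f_linear : linear f.
  by move=> r u v; apply/esym; apply: G_uniq; apply: (GD) => //; exact: GZ.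
have [h hf] := linear_bundle f_linear.
exists h => [a u hu|w]; last by rewrite hf; apply/esym/G_uniq.
have comp_f b : component b (h u) = f (component b u).
  by rewrite hf; apply: G_uniq; exact: compG.
suff -> : h u = component a (h u) by exact: component_homog.
apply/eqP; rewrite -subr_eq0; apply/eqP; apply: component_eq0 => b.
rewrite componentB (component_of_homog b (component_homog a (h u))).
case: eqP => [->|ba]; first exact: subrr.
rewrite subr0 comp_f (component_of_homog b hu); case: eqP => // _.
by apply/esym; exact: G_uniq.
Qed.

End Injective.

(** * The submodule S_x of E_x *)

Section Submodule.
Variables (K : fieldType) (d : Order.disp_t) (P : finBPOrderType d) (x : P).
Local Notation S := (polyS K P).
Local Notation E := (env K x).
Local Notation tensor := {malg K[(lexp x * iexp x)%type]}.
Local Notation polyx := {malg K[{cmonom (vx x)}]}.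
Local Notation grade := 'rV[int]_(nvert P).

#[local] Opaque bas env_scale.

Definition iexp0 : iexp x := [ffun=> 0%N].
Definition env_one : E := bas K (0, iexp0).

Lemma tvar_iexp0 (z : P) a : tvar K z *: bas K (a, iexp0) =
  if (z <= x)%O then bas K (lexp_shift z a, iexp0) else 0.
Proof.
have [z0|z0] := eqVneq z \bot%O.
  rewrite z0 le0x tvar_bot scale1r; congr bas; congr pair.
  by apply/ffunP => i; rewrite !ffunE supp_bot inE addr0.
rewrite -[z]/(val (Sub z z0 : pstar P)) tvar_bas /lopt /iopt /=.
set r := (X in _ + X); suff -> : r = 0 by rewrite addr0; case: (z <= x)%O.
by rewrite /r; case: insub => // w; rewrite ffunE.
Qed.

(** The embedding of K[t_i] in E_x whose image is S_x. *)
Definition poly_env (q : polyx) : E := tens (poly_laurent q) (one_inv K x).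

Lemma poly_envU (k : {cmonom (vx x)}) :
  poly_env << k >> = bas K ([ffun i => (k i)%:Z], iexp0).
Proof. by rewrite /poly_env /poly_laurent linextU tensU. Qed.

Lemma poly_env_linear : linear (poly_env : polyx -> tensor).
Proof. by move=> c u v; rewrite /poly_env /poly_laurent linearP /tens linearP. Qed.

Lemma pi_varE (z : P) : (z <= x)%O -> exists2 k : {cmonom (vx x)},
  pi_var K x z = << k >> & forall i, k i = (val i \in supp z).
Proof.
move=> zx; exists (\big[@mmul _/mone]_(i : vx x | val i \in supp z) ucm i).
  rewrite /pi_var zx; symmetry.
  exact: (big_morph (fun m : {cmonom (vx x)} => << m >>) (malgUM K (I := vx x)) erefl).
move=> i; rewrite (big_morph (fun m : {cmonom (vx x)} => m i) (fun m k => cmM i m k) (cm1 i)).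
rewrite big_mkcond (bigD1 i isT) cmUU big1 => [|j /negbTE ji].
  by case: (_ \in _).
by rewrite cmU ji; case: (_ \in _).
Qed.

Lemma tvar_poly_env (z : pstar P) (q : polyx) :
  tvar K (val z) *: poly_env q = poly_env (pi_var K x (val z) * q).
Proof.
have [f fE] := linear_bundle poly_env_linear.
have lin2 : linear ((fun q => poly_env (pi_var K x (val z) * q)) : polyx -> tensor).
  by move=> c u v; rewrite mulrDr -scalerAr poly_env_linear.
have [g gE] := linear_bundle lin2.
have lin1 : linear ((fun q => env_act z (poly_env q)) : polyx -> tensor).
  by move=> c u v; rewrite poly_env_linear linearP.
have [h hE] := linear_bundle lin1.
rewrite env_scale_tvar -gE -hE; apply: linear_ext_basis => k.
rewrite gE hE poly_envU -env_scale_tvar tvar_iexp0.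
case: ifPn => zx; last first.
  by rewrite /pi_var (negbTE zx) mul0r -fE linear0.
have [m -> mi] := pi_varE zx.
rewrite -malgUM poly_envU; congr bas; congr pair.
by apply/ffunP => i; rewrite !ffunE cmM mi addrC PoszD.
Qed.

(** The inverse system factor of env_one is killed by all the variables that act
    on it, so only the action through pi_x remains. *)
Lemma poly_env_pi (p : S) : poly_env (pi_x x p) = p *: env_one.
Proof.
have lin1 : linear ((fun p => poly_env (pi_x x p)) : S -> tensor).
  by move=> c u v; rewrite /pi_x linearP poly_env_linear.
have lin2 : linear ((fun p => p *: env_one) : S -> tensor).
  by move=> c u v; exact: (linearP (linext (fun m => monact (env_act (K := K) (x := x)) m env_one))).
have [f fE] := linear_bundle lin1; have [g gE] := linear_bundle lin2.
rewrite -gE -fE; apply: linear_ext_basis => m; rewrite gE fE.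
have -> : pi_x x << m >> = \prod_(z : pstar P) pi_var K x (val z) ^+ m z by exact: linextU.
have -> : << m >> = \prod_(z : pstar P) tvar K (val z) ^+ m z :> S.
  by rewrite malg_monomE; apply: eq_bigr => z _; rewrite /tvar valK.
elim/big_rec2: _ => [|z q r _ IH].
  rewrite scale1r; have -> : 1 = << mone >> :> polyx by [].
  by rewrite poly_envU; congr bas; congr pair; apply/ffunP => i; rewrite !ffunE cm1.
elim: (m z) => [|k IHk]; first by rewrite !expr0 !mul1r.
rewrite exprS -mulrA -tvar_poly_env IHk; exact: (@scale_exprS_mul S E).
Qed.

Lemma Sx_subP (e : E) : Sx_sub K x e <-> exists p : S, e = p *: env_one.
Proof.
split=> [[q ->]|[p ->]]; last by exists (pi_x x p); rewrite -poly_env_pi.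
rewrite -/(poly_env q); have [f fE] := linear_bundle poly_env_linear.
rewrite [q]malg_basis -fE linear_sum.
elim/big_ind: _ => [|u v [p ->] [p' ->]|k _]; first by exists 0; rewrite scale0r.
  by exists (p + p'); rewrite scalerDl.
exists ((q@_k)%:A * tmon K [ffun i => k i]).
rewrite linearZ /= fE poly_envU -scalerA tmon_bas -env_constE.
congr (_ *: _); congr bas; congr pair.
by apply/ffunP => i; rewrite !ffunE add0r.
Qed.

Lemma env_one_homog : env_homog 0 env_one.
Proof.
have -> : 0 = envdeg (0, iexp0) :> grade.
  rewrite /envdeg !big1 ?subr0 // => [w _|i _]; first by rewrite ffunE.
  by rewrite ffunE.
exact: env_homogU.
Qed.

(** ** The annihilator of 1 *)

#[local] Opaque tvar.

Hypothesis simpP : simplicial_poset P.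

(** If y, z <= x, then both terms of the face relation act on 1 as the same
    Laurent monomial, since y /\ z and the unique join of y and z below x have
    together the same vertices as y and z; otherwise both terms act as 0. *)
Lemma face_rel_one (y z : pstar P) : face_rel K (val y) (val z) *: env_one = 0.
Proof.
have -> : face_rel K (val y) (val z) *: env_one =
    tvar K (val y) *: (tvar K (val z) *: env_one) -
    tvar K (pmeet (val y) (val z)) *:
      ((\sum_(w in joins (val y) (val z)) tvar K w) *: env_one).
  exact: (@scale_subM S E).
have -> : (\sum_(w in joins (val y) (val z)) tvar K w) *: env_one =
    \sum_(w in joins (val y) (val z)) tvar K w *: env_one.
  exact: scaler_suml.
have tE w : tvar K w *: env_one = _ := tvar_iexp0 w 0.
have [/andP[yx zx]|yzx] := boolP ((val y <= x)%O && (val z <= x)%O); last first.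
  rewrite big1 ?scaler0 ?subr0 => [|w wj].
    rewrite tE; case: (boolP (val z <= x)%O) => zx; last exact: scaler0.
    by rewrite tvar_iexp0; move: yzx; rewrite zx andbT => /negbTE ->.
  rewrite tE ifF //; apply: contraNF yzx => wx.
  by move: wj; rewrite inE => /and3P[yw zw _]; rewrite !(le_trans _ wx).
have [w [wx ws wj w_uniq]] := joins_interval simpP yx zx.
have [mx ms] := supp_pmeet simpP yx zx.
have -> : \sum_(w' in joins (val y) (val z)) tvar K w' *: env_one = tvar K w *: env_one.
  rewrite (bigD1 w) //= big1 ?addr0 // => w' /andP[w'j w'w].
  rewrite tE ifF //; apply: contraNF w'w => w'x.
  by apply/eqP; exact: w_uniq.
rewrite !tE zx wx 2!tvar_iexp0 yx mx; apply/eqP; rewrite subr_eq0; apply/eqP.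
congr bas; congr pair; apply/ffunP => i; rewrite !ffunE ms ws !inE.
by case: (vert _ <= val y)%O; case: (_ <= _)%O.
Qed.

Local Notation pxK := (@px K d P x).

Lemma px_ann (p : S) : p \in pxK -> p *: env_one = 0.
Proof.
have idA := @ann_ideal S E env_one.
move=> /asboolP[q [r [-> fr qx]]].
have q0 : q *: env_one = 0.
  apply: (ideal_gen_ind idA _ qx) => _ [z zx ->].
  by rewrite tvar_iexp0 (negbTE zx).
have r0 : r *: env_one = 0.
  by apply: (ideal_gen_ind idA _ fr) => _ [y [z ->]]; exact: face_rel_one.
by rewrite scalerDl q0 r0 addr0.
Qed.

Lemma px_tvar (z : P) : ~~ (z <= x)%O -> tvar K z \in pxK.
Proof.
move=> zx; have z0 : z != \bot%O by apply: contra zx => /eqP ->; exact: le0x.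
apply/asboolP; exists (tvar K z), 0; rewrite addr0; split=> //; first exact: ideal_gen0.
by apply: ideal_gen_mem; exists (Sub z z0).
Qed.

Lemma px_face_rel (y z : pstar P) : face_rel K (val y) (val z) \in pxK.
Proof.
apply/asboolP; exists 0, (face_rel K (val y) (val z)); rewrite add0r; split=> //.
  by apply: ideal_gen_mem; exists y, z.
exact: ideal_gen0.
Qed.

Lemma px_trans (p q r : S) : p - q \in pxK -> q - r \in pxK -> p - r \in pxK.
Proof.
move=> pq qr; have := rpredD pq qr.
by have -> : (p - q) + (q - r) = p - r by exact: subrKA.
Qed.

Lemma px_eq (p q : S) : p = q -> q \in pxK -> p \in pxK.
Proof. by move=> ->. Qed.

Definition supp_exp (z : P) : {ffun vx x -> nat} := [ffun i => (val i \in supp z : nat)].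

(** Splitting off one vertex of z: the face relation of that vertex and the
    complementary face z' of z has z as its only join below x. *)
Lemma px_monomial (z : P) : (z <= x)%O -> tvar K z - tmon K (supp_exp z) \in pxK.
Proof.
have [suppE supp_surj] := supp_interval simpP x.
have [n] := ubnP #|supp z|; elim: n z => // n IHn z; rewrite ltnS => sz zx.
have [z0|[i iz]] := set_0Vmem (supp z).
  have -> : z = \bot%O by apply: (supp_inj simpP zx) => //; rewrite ?le0x // supp_bot.
  rewrite tvar_bot; have -> : supp_exp \bot%O = [ffun=> 0%N].
    by apply/ffunP => j; rewrite !ffunE supp_bot inE.
  by rewrite tmon0 subrr rpred0.
have yz : (vert i <= z)%O by move: iz; rewrite inE.
have yx := le_trans yz zx.
have ix : i \in supp x by rewrite inE.
have [|z' z'x z's] := supp_surj (supp z :\ i).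
  by rewrite (subset_trans (subD1set _ _)) // supp_mono.
have yE : tvar K (vert i) = tmon K (supp_exp (vert i)).
  rewrite -[i]/(val (Sub i ix : vx x)) -tmonU; congr (tmon K).
  by apply/ffunP => j; rewrite !ffunE supp_vert inE -(inj_eq val_inj).
have zE : tmon K (supp_exp z) = tvar K (vert i) * tmon K (supp_exp z').
  rewrite yE tmonD; congr (tmon K); apply/ffunP => j; rewrite !ffunE z's supp_vert.
  rewrite in_setD1 in_set1; have [->|_] /= := eqVneq (val j) i; last by rewrite add0n.
  by rewrite iz addn0.
rewrite zE; have {}IHn : tvar K z' - tmon K (supp_exp z') \in pxK.
  by apply: IHn => //; rewrite z's; move: sz; rewrite (cardsD1 i) iz.
have := pxM (tvar K (vert i)) IHn; rewrite mulrBr => IH.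
apply: px_trans IH.
have [z'0|z'0] := eqVneq z' \bot%O.
  suff -> : tvar K z = tvar K (vert i) * tvar K z' by rewrite subrr rpred0.
  rewrite z'0 tvar_bot mulr1; congr (tvar K); apply: (supp_inj simpP zx yx).
  have : supp z :\ i == finset.set0 by rewrite -z's z'0 supp_bot.
  by rewrite supp_vert setD_eq0 subset1 => /orP[/eqP//|/eqP z0]; rewrite z0 inE in iz.
pose y : pstar P := Sub (vert i) (vert_neq_bot i).
have := px_face_rel y (Sub z' z'0); rewrite /face_rel /=.
have [mx ms] := supp_pmeet simpP yx z'x.
have -> : pmeet (vert i) z' = \bot%O.
  apply: (supp_inj simpP mx); rewrite ?le0x // ms supp_bot z's supp_vert.
  by apply/setP => j; rewrite !inE; case: eqP.
rewrite tvar_bot mul1r; have [w [wx ws wj w_uniq]] := joins_interval simpP yx z'x.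
have wz : w = z.
  apply: (supp_inj simpP wx zx); rewrite ws supp_vert z's.
  by rewrite setD1K.
rewrite (bigD1 w wj) wz; set r := \sum_(_ | _) _.
have rpx : r \in pxK.
  rewrite /r; elim/big_ind: _ => [|p q|w' /andP[w'j w'z]]; [exact: rpred0|exact: rpredD|].
  apply: px_tvar.
  by apply: contra w'z => w'x; rewrite -wz; apply/eqP; exact: w_uniq.
move=> h; apply: (px_trans (q := tvar K z + r)).
  have -> : tvar K z - (tvar K z + r) = - r by rewrite opprD addrA subrr add0r.
  by rewrite rpredN.
have -> : tvar K z + r - tvar K (vert i) * tvar K z' =
  - (tvar K (vert i) * tvar K z' - (tvar K z + r)) by rewrite opprB.
by rewrite rpredN.
Qed.

Lemma px_svar (w : pminus x) : svar K w \in pxK.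
Proof.
rewrite /svar; case: ifPn => wx; last by rewrite subr0 px_tvar.
exact: px_monomial.
Qed.

(** Modulo the s_w, every polynomial is a combination of monomials t^n, and these
    act on env_one as distinct basis elements. *)
Lemma ann_px (p : S) : p *: env_one = 0 -> p \in pxK.
Proof.
(* sg maps the Laurent monomials with nonnegative exponents back to S, so that
   q and sg (q *: env_one) agree modulo the prime ideal *)
have [sg [sgD sgZ sgU sg0]] : exists sg : E -> S,
    [/\ forall u v, sg (u + v) = sg u + sg v, forall c u, sg (c%:A *: u) = c *: sg u,
    forall c, sg (bas K c) = tmon K [ffun i => `|c.1 i|%N] & sg 0 = 0].
  exists (linext (fun c : lexp x * iexp x => tmon K [ffun i => `|c.1 i|%N])).
  split=> [u v|c u|c|].
  - exact: (linearD (linext _)).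
  - by rewrite env_constE; exact: (linearZ_LR (linext _)).
  - exact: linextU.
  - exact: (linear0 (linext _)).
pose W (q : S) := q - sg (q *: env_one) \in pxK.
have Wsub : submodule (W : {malg K[_]} -> Prop).
  split=> [|q q' Wq Wq'|c q Wq].
  - by rewrite /W scale0r sg0 subr0 rpred0.
  - have e : (q + q') - sg ((q + q') *: env_one) =
        (q - sg (q *: env_one)) + (q' - sg (q' *: env_one)).
      by rewrite scalerDl sgD; exact: subrDD.
    exact: px_eq e (rpredD Wq Wq').
  - have e : c *: q - sg ((c *: q) *: env_one) = c%:A * (q - sg (q *: env_one)).
      have -> : (c *: q) *: env_one = c%:A *: (q *: env_one) by exact: (@scale_algA K S E).
      apply: etrans (congr1 (fun y => c *: q - y) (sgZ c (q *: env_one))) _.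
      exact: (@scaler_subA K S).
    exact: px_eq e (pxM c%:A Wq).
suff Wp : W p by move=> p0; move: Wp; rewrite /W p0 sg0 subr0.
have [W0 WD WZ] := Wsub.
rewrite [p]malg_basis; elim/big_ind: _ => [|q q'|m _]; [exact: W0|exact: WD|].
apply: (WZ).
apply: spanned_monomial Wsub _ => n b _.
have sE := smon_bas K b 0 iexp0.
apply: (px_eq (congr1 (fun v => tmon K n * smon K b - sg v)
  (esym (scalerA (tmon K n) (smon K b) env_one)))).
apply: (px_eq (congr1 (fun v => tmon K n * smon K b - sg (tmon K n *: v)) sE)).
case: (boolP [forall w, (b w <= iexp0 w)%N]) => [/forallP b0|].
  have -> : b = iexp0.
    by apply/ffunP => w; have := b0 w; rewrite !ffunE leqn0 => /eqP.
  have -> : [ffun w => iexp0 w - iexp0 w]%N = iexp0.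
    by apply/ffunP => w; rewrite !ffunE.
  apply: (px_eq (congr1 (fun v => tmon K n * smon K iexp0 - sg v) (tmon_bas K n _))).
  rewrite sgU smon0 mulr1 /=.
  set n' := [ffun _ => _]; suff -> : n' = n by rewrite subrr; exact: rpred0.
  by apply/ffunP => i; rewrite !ffunE add0r.
rewrite negb_forall => /existsP[w]; rewrite ffunE -ltnNge => bw.
rewrite scaler0 sg0 subr0; apply: pxM.
have -> : smon K b = smon K [ffun v => b v - (v == w)]%N * svar K w.
  rewrite -smonU smonD; congr (smon K); apply/ffunP => v; rewrite !ffunE subnK //.
  by case: eqP => [->|].
by apply: pxM; exact: px_svar.
Qed.

(** ** The isomorphism of S / p_x with the submodule *)

Lemma Sx_embedding : exists iota : {linear Sx K x -> Ex K x},
  (forall p : S, iota (Sx_pi x p) = p *: env_one) /\ injective iota.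
Proof.
pose f (u : Sx K x) : Ex K x := (repr (u : Quotient.quot pxK) : S) *: env_one.
have fE p : f (Sx_pi x p) = p *: env_one.
  apply/eqP; rewrite -subr_eq0 /f -scalerBl; apply/eqP/px_ann.
  by apply/Sx_piP; rewrite Sx_piK.
have f_lin : linear f.
  move=> r u v; rewrite -[u]Sx_piK -[v]Sx_piK.
  set p := repr _; set q := repr _.
  have -> : r *: Sx_pi x p + Sx_pi x q = Sx_pi x (r * p + q).
    by rewrite Sx_piD -Sx_scale_pi.
  by rewrite !fE scalerDl scalerA.
have [iota iotaE] := linear_bundle f_lin.
exists iota; split=> [p|u v]; first by rewrite iotaE.
rewrite !iotaE => uv; rewrite -[u]Sx_piK -[v]Sx_piK; apply/Sx_piP/ann_px.
by rewrite scalerBl; apply/eqP; rewrite subr_eq0; apply/eqP.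
Qed.

(** ** Essentiality *)

(** If (a, b) is in the support of u with b of maximal total degree, then s^b
    kills every other term of u; a power of the t_i moves the remaining term
    into S_x. *)
Lemma Sx_essential : star_essential (Sx_sub K x).
Proof.
split.
  split=> [|u v /Sx_subP[p ->] /Sx_subP[q ->]|p u /Sx_subP[q ->]|u /Sx_subP[p ->]].
  - by apply/Sx_subP; exists 0; rewrite scale0r.
  - by apply/Sx_subP; exists (p + q); rewrite scalerDl.
  - by apply/Sx_subP; exists (p * q); rewrite scalerA.
  have [s us] := componentE (p *: env_one : Ex K x).
  exists s, (fun a => component a (p *: env_one : Ex K x)); split=> // a.
  split; first exact: component_homog.
  apply/Sx_subP; exists (Scomponent (a - 0) p).
  exact: (component_scale (M := Ex K x) a p env_one_homog).
move=> nu u hu u0.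
have [c0 c0u] : exists c, c \in msupp (u : tensor).
  have [uz|[c cu]] := fset_0Vmem (msupp (u : tensor)); last by exists c.
  case/eqP: u0; apply/malgP => c; rewrite mcoeff0; apply: mcoeff_outdom.
  by rewrite uz in_fset0.
have [[a b] abu bmax] := max_in_seq (fun c : lexp x * iexp x => \sum_w c.2 w)%N c0u.
have ab_deg := hu _ abu.
have term c : c \in msupp (u : tensor) -> c != (a, b) -> smon K b *: bas K c = 0.
  case: c => a' b' cu cab; rewrite smon_bas.
  case: (boolP [forall w, _]) => [/forallP le|//].
  have bb : b' = b.
    apply/ffunP => w; apply/eqP; rewrite eqn_leq le andbT leqNgt.
    apply/negP => lt; have := bmax _ cu; apply/negP; rewrite -ltnNge /=.
    rewrite (bigD1 w) //= [X in (_ < X)%N](bigD1 w) //= -addSn leq_add //.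
    exact: leq_sum.
  case/eqP: cab; rewrite bb; congr (_, _).
  apply: (@vdeg_inj _ _ x); have := hu _ cu; rewrite bb -ab_deg.
  exact: addIr.
have su : smon K b *: u = ((u : tensor)@_(a, b))%:A *: bas K (a, iexp0).
  rewrite {1}[u]env_basE scaler_sumr (bigD1_seq (a, b)) ?fset_uniq //=.
  rewrite big1_seq ?addr0 => [|c /andP[cab cu]].
    rewrite scalerA mulrC -scalerA smon_bas; case: (boolP [forall w, _]) => [_|/forallP[]//].
    by congr (_ *: _); congr bas; congr pair; apply/ffunP => w; rewrite !ffunE subnn.
  by rewrite scalerA mulrC -scalerA term // scaler0.
have [n [n' an]] := lnat_shift a.
exists (tmon K n' * smon K b); set k := (u : tensor)@_(a, b) in su.
have one_n : tmon K n *: env_one = bas K (lnat n, iexp0).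
  by rewrite /env_one tmon_bas /= add0r.
have bas_n : tmon K n' *: bas K (a, iexp0) = bas K (lnat n, iexp0).
  by rewrite tmon_bas /= -an.
have pu : (tmon K n' * smon K b : S) *: u = k%:A *: (tmon K n *: env_one).
  apply: etrans (esym (scalerA _ _ u)) _.
  apply: etrans (congr1 (fun v => tmon K n' *: v) su) _.
  apply: etrans (scale_swap _ _ _) _.
  exact: (congr1 (fun v => k%:A *: v) (etrans bas_n (esym one_n))).
split.
  apply/Sx_subP; exists (k%:A * tmon K n).
  exact: etrans pu (scalerA _ _ _).
apply/eqP => pu0; have := etrans (esym pu) pu0; rewrite one_n env_constE.
move=> /malgP/(_ (lnat n, iexp0)); rewrite mcoeffZ mcoeff0.
rewrite mcoeffUU mulr1; apply/eqP.
by rewrite mcoeff_neq0.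
Qed.

End Submodule.

Theorem theorem2p7 (d : Order.disp_t) (P : finBPOrderType d) (K : fieldType)
    (x : P) (hP : simplicial_poset P) :
  [/\ star_injective (Ex K x),
      star_essential (Sx_sub K x)
    & exists iota : {linear Sx K x -> Ex K x},
        [/\ forall p : polyS K P,
              iota (Sx_pi x p) = tens (poly_laurent (pi_x x p)) (one_inv K x),
            injective iota,
            forall e : Ex K x, Sx_sub K x e <-> exists u, e = iota u
          & forall a (p : polyS K P),
              homogS a p -> homog (Ex K x) a (iota (Sx_pi x p))]].
Proof.
split; [exact: baer_star_injective (@Ex_baer K d P x)|exact: Sx_essential|].
have [iota [iotaE iota_inj]] := Sx_embedding K x hP.
exists iota; split=> // [p|e|a p pa].
- by rewrite iotaE -poly_env_pi.
- split=> [/Sx_subP[p ->]|[u ->]]; first by exists (Sx_pi x p); rewrite iotaE.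
  by apply/Sx_subP; rewrite -[u]Sx_piK iotaE; eexists.
rewrite iotaE -[a]addr0; apply: homog_scale => //; exact: env_one_homog.
Qed.
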